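(* Let $A, B \subset \mathbb{R}^2$ be planar convex bodies with $A \subseteq B$, and let $\alpha \in \,]0,\tfrac12[$. Then there exists an $\alpha$-section of $A$ which is a $\beta$-section of $B$ for some $\beta \geq \alpha$.
   Context: A planar convex body is a compact convex subset of $\mathbb{R}^2$ with nonempty interior; $|X|$ denotes area. For an oriented straight line $\Delta$ with direction $\theta$, i.e. oriented by $(\cos\theta,\sin\theta)$ and at signed distance $t$ from the origin, $\Delta^+ = \{x \in \mathbb{R}^2 : \langle x, (-\sin\theta,\cos\theta)\rangle \geq t\}$ is the closed half-plane on its left and $\Delta^-$ the closed half-plane on its right. For $\gamma \in \,]0,1[$ and a planar convex body $K$, a $\gamma$-section of $K$ is an oriented line $\Delta$ with $|\Delta^- \cap K| = \gamma |K|$. *)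

(* Defs.v *)
From Stdlib Require Import Reals Lra List ClassicalEpsilon.
Open Scope R_scope.

Definition pt := (R * R)%type.
Definition region := pt -> Prop.

Definition dist2 (p q : pt) : R :=
  (fst p - fst q) ^ 2 + (snd p - snd q) ^ 2.

(* Compact = closed and bounded (Heine-Borel in R^2). *)
Definition closed_set (K : region) : Prop :=
  forall p, (forall eps, 0 < eps -> exists q, K q /\ dist2 p q < eps) -> K p.
Definition bounded_set (K : region) : Prop :=
  exists M, forall p, K p -> dist2 p (0, 0) <= M.
Definition convex_set (K : region) : Prop :=
  forall p q (l : R), K p -> K q -> 0 <= l <= 1 ->
    K (l * fst p + (1 - l) * fst q, l * snd p + (1 - l) * snd q).
Definition nonempty_interior (K : region) : Prop :=
  exists p r, 0 < r /\ forall q, dist2 p q < r -> K q.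

Definition convex_body (K : region) : Prop :=
  closed_set K /\ bounded_set K /\ convex_set K /\ nonempty_interior K.

(* Area: inner Jordan content (sup of total areas of finitely many
   interior-disjoint closed axis-parallel rectangles contained in S).
   For convex bodies and their intersections with half-planes (which are
   convex compact sets) this coincides with Lebesgue measure. *)
Record rect := mkRect { rx0 : R; rx1 : R; ry0 : R; ry1 : R }.

Definition rect_ok (r : rect) : Prop := rx0 r <= rx1 r /\ ry0 r <= ry1 r.
Definition rect_area (r : rect) : R := (rx1 r - rx0 r) * (ry1 r - ry0 r).
Definition in_rect (r : rect) (p : pt) : Prop :=
  rx0 r <= fst p <= rx1 r /\ ry0 r <= snd p <= ry1 r.
Definition interior_disjoint (r s : rect) : Prop :=
  rx1 r <= rx0 s \/ rx1 s <= rx0 r \/ ry1 r <= ry0 s \/ ry1 s <= ry0 r.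

Fixpoint pairwise_disjoint (l : list rect) : Prop :=
  match l with
  | nil => True
  | r :: l' => (forall s, In s l' -> interior_disjoint r s) /\ pairwise_disjoint l'
  end.

Definition inner_sums (S : region) (a : R) : Prop :=
  exists l : list rect,
    (forall r, In r l -> rect_ok r /\ (forall p, in_rect r p -> S p)) /\
    pairwise_disjoint l /\
    a = fold_right (fun r acc => rect_area r + acc) 0 l.

Definition area (S : region) : R :=
  epsilon (inhabits 0) (fun m => is_lub (inner_sums S) m).

Definition inter (X Y : region) : region := fun p => X p /\ Y p.

(* Oriented line with direction theta, signed distance t: its right closed
   half-plane Delta^- = { x : <x, (-sin theta, cos theta)> <= t }. *)
Definition half_minus (theta t : R) : region :=
  fun x => - sin theta * fst x + cos theta * snd x <= t.
Definition half_plus (theta t : R) : region :=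
  fun x => - sin theta * fst x + cos theta * snd x >= t.

Definition is_section (gamma : R) (K : region) (theta t : R) : Prop :=
  0 < gamma < 1 /\ area (inter (half_minus theta t) K) = gamma * area K.

(* Main.v *)
(** Put B \ A against A.  Starting at a boundary point p_0 of A, let p_(i+1) be the
    boundary point such that the chord p_i p_(i+1) cuts off, on its right, a cap H_i of
    area alpha |A|.  As the chain runs around A, a point outside A lies in at least
    about as many of the half-planes H_i as any point of A does: up to an additive
    constant 3, both numbers are the number of turns.  To compare them, count for a line
    through A the steps p_i p_(i+1) crossing it from left to right.  For a line halving
    A through x outside A, each such step has x on its right; for the line of a chord
    whose cap contains y in A, all but one of the caps containing y can be charged
    injectively to such steps; and the counts for two lines meeting inside A differ by
    at most 1, because a step crosses too small a cap to skip half of A.  Averaging over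
    A and over B \ A, some H_i with i < n satisfies |H_i /\ B| >= (alpha - 3/n) |B|, and
    a limit of these lines as n grows is the required section. *)
Require Import Defs.
From Stdlib Require Import Reals Lra Lia List ClassicalEpsilon Classical.
From Stdlib Require Import FunctionalExtensionality PropExtensionality.
Open Scope R_scope.

(** * Sums and counting *)

(** [area] is only a supremum over rectangle packings, so neither additivity nor an integral is
    available at the start. For bounded convex sets it is shown to be the limit of normalised
    lattice counts. A count is a finite sum, so areas are compared, and the average over pairs of
    points is taken, by pointwise inequalities between indicators at a fixed mesh, followed by a
    limit. B \ A is not convex and never receives an area of its own: it occurs as the difference of
    the indicators of B and A. The chain of chords need not close up and the boundary of A is never
    parametrised. Turns are replaced by signs of affine functions at the vertices, and two crossing
    counts are compared through a potential with values in [0, 1] that telescopes. The delicate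
    cases are vertices and steps lying on the line in question. Besides bounding single steps, alpha
    < 1/2 ensures that two consecutive caps cannot cover A, which makes the chain turn left. *)

Fixpoint nsum (n : nat) (f : nat -> R) : R :=
  match n with
  | O => 0
  | S k => nsum k f + f k
  end.

Lemma nsum_le (n : nat) (f g : nat -> R) :
  (forall i, (i < n)%nat -> f i <= g i) -> nsum n f <= nsum n g.
Proof.
induction n as [|n IH]; intros H; simpl; [lra|].
assert (nsum n f <= nsum n g) by (apply IH; intros; apply H; lia).
assert (f n <= g n) by (apply H; lia).
lra.
Qed.

Lemma nsum_ext (n : nat) (f g : nat -> R) :
  (forall i, (i < n)%nat -> f i = g i) -> nsum n f = nsum n g.
Proof.
intros H; apply Rle_antisym; apply nsum_le; intros i Hi; rewrite (H i Hi); lra.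
Qed.

Lemma nsum_plus (n : nat) (f g : nat -> R) :
  nsum n (fun i => f i + g i) = nsum n f + nsum n g.
Proof. induction n as [|n IH]; simpl; lra. Qed.

Lemma nsum_minus (n : nat) (f g : nat -> R) :
  nsum n (fun i => f i - g i) = nsum n f - nsum n g.
Proof. induction n as [|n IH]; simpl; lra. Qed.

Lemma nsum_scal (n : nat) (c : R) (f : nat -> R) :
  nsum n (fun i => c * f i) = c * nsum n f.
Proof. induction n as [|n IH]; simpl; [lra|]. rewrite IH; ring. Qed.

Lemma nsum_const (n : nat) (c : R) : nsum n (fun _ => c) = INR n * c.
Proof. induction n as [|n IH]; [simpl; lra|]. rewrite S_INR; simpl; lra. Qed.

Lemma nsum_nonneg (n : nat) (f : nat -> R) :
  (forall i, (i < n)%nat -> 0 <= f i) -> 0 <= nsum n f.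
Proof.
intros H. replace 0 with (nsum n (fun _ => 0)) by (rewrite nsum_const; ring).
now apply nsum_le.
Qed.

Lemma nsum_swap (n m : nat) (f : nat -> nat -> R) :
  nsum n (fun i => nsum m (fun j => f i j)) = nsum m (fun j => nsum n (fun i => f i j)).
Proof.
induction n as [|n IH]; simpl.
- rewrite nsum_const; ring.
- rewrite IH, nsum_plus; reflexivity.
Qed.

Definition chi (P : Prop) : R := if excluded_middle_informative P then 1 else 0.

Lemma ind_true (P : Prop) : P -> chi P = 1.
Proof. unfold chi; destruct (excluded_middle_informative P); tauto. Qed.

Lemma ind_false (P : Prop) : ~ P -> chi P = 0.
Proof. unfold chi; destruct (excluded_middle_informative P); tauto. Qed.

Lemma ind_cases (P : Prop) : (P /\ chi P = 1) \/ (~ P /\ chi P = 0).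
Proof. unfold chi; destruct (excluded_middle_informative P); tauto. Qed.

Lemma ind_bounds (P : Prop) : 0 <= chi P <= 1.
Proof. destruct (ind_cases P) as [[_ E]|[_ E]]; lra. Qed.

Lemma ind_le (P Q : Prop) : (P -> Q) -> chi P <= chi Q.
Proof.
intros H; destruct (ind_cases P) as [[HP E]|[HP E]];
  destruct (ind_cases Q) as [[HQ E']|[HQ E']]; try lra; tauto.
Qed.

Ltac ind_split P := 
  let H := fresh "Hi" in let E := fresh "Ei" in
  destruct (ind_cases P) as [[H E]|[H E]]; rewrite ?E in *.

(** [g] clamps to [x0 + d, x1]. From t to t + d it grows by at most d, and only if x0 < t < x1, so
    its increments telescope below the count. For an interval shorter than d the left side is
    negative. *)
Lemma count_lower (a d x0 x1 : R) (n : nat) :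
  0 < d -> a <= x0 -> x1 <= a + INR n * d ->
  x1 - x0 - d <= nsum n (fun i => d * chi (x0 <= a + INR i * d < x1)).
Proof.
intros Hd Ha Hn.
destruct (Rlt_or_le x1 (x0 + d)) as [Hs|Hs].
- assert (0 <= nsum n (fun i => d * chi (x0 <= a + INR i * d < x1))); [|lra].
  apply nsum_nonneg; intros i _.
  pose proof (ind_bounds (x0 <= a + INR i * d < x1)); nra.
- set (g := fun t => Rmin (Rmax t (x0 + d)) x1).
  assert (H : forall k, g (a + INR k * d) - g a
     <= nsum k (fun i => d * chi (x0 <= a + INR i * d < x1))).
  { induction k as [|k IH].
    - simpl; rewrite Rmult_0_l, Rplus_0_r; lra.
    - rewrite S_INR; simpl.
      set (t := a + INR k * d) in *.
      replace (a + (INR k + 1) * d) with (t + d) by (unfold t; ring).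
      ind_split (x0 <= t < x1); unfold g, Rmin, Rmax in *;
      repeat match goal with |- context [Rle_dec ?u ?v] => destruct (Rle_dec u v)
      | H : context [Rle_dec ?u ?v] |- _ => destruct (Rle_dec u v) end; try lra;
      exfalso; apply Hi; lra. }
  specialize (H n).
  assert (g a = x0 + d).
  { unfold g, Rmin, Rmax; repeat (destruct (Rle_dec _ _)); lra. }
  assert (g (a + INR n * d) = x1).
  { unfold g, Rmin, Rmax; repeat (destruct (Rle_dec _ _)); lra. }
  lra.
Qed.

(** Here [g] clamps to [x0, x1 + d]: it never decreases, and from every t in [x0, x1] it grows by
    exactly d. *)
Lemma count_upper (a d x0 x1 : R) (n : nat) :
  0 < d -> x0 <= x1 ->
  nsum n (fun i => d * chi (x0 <= a + INR i * d <= x1)) <= x1 - x0 + d.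
Proof.
intros Hd Hx.
set (g := fun t => Rmin (Rmax t x0) (x1 + d)).
assert (H : forall k, nsum k (fun i => d * chi (x0 <= a + INR i * d <= x1))
                      <= g (a + INR k * d) - g a).
{ induction k as [|k IH].
  - simpl; rewrite Rmult_0_l, Rplus_0_r; lra.
  - rewrite S_INR; simpl.
    set (t := a + INR k * d) in *.
    replace (a + (INR k + 1) * d) with (t + d) by (unfold t; ring).
    ind_split (x0 <= t <= x1); unfold g, Rmin, Rmax in *;
    repeat match goal with |- context [Rle_dec ?u ?v] => destruct (Rle_dec u v)
    | H : context [Rle_dec ?u ?v] |- _ => destruct (Rle_dec u v) end; lra. }
specialize (H n).
assert (g (a + INR n * d) <= x1 + d) by (unfold g; apply Rmin_r).
assert (x0 <= g a) by (unfold g; apply Rmin_glb; [apply Rmax_r|lra]).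
lra.
Qed.

(* [Q] will be membership in a convex set along a lattice row or column. *)
Lemma exit_count (n : nat) (Q : nat -> Prop) :
  (forall i k j, (i <= k <= j)%nat -> Q i -> Q j -> Q k) ->
  nsum n (fun i => chi (Q i /\ ~ Q (S i))) <= 1.
Proof.
intros HQ.
assert (H : forall k, nsum k (fun i => chi (Q i /\ ~ Q (S i)))
   <= chi (exists i, (i < k)%nat /\ Q i /\ ~ Q (S i))).
{ induction k as [|k IH]; simpl.
  - apply ind_bounds.
  - ind_split (Q k /\ ~ Q (S k)).
    + rewrite (ind_false (exists i, (i < k)%nat /\ Q i /\ ~ Q (S i))) in IH.
      * rewrite (ind_true (exists i, (i < S k)%nat /\ Q i /\ ~ Q (S i))); [lra|].
        exists k; split; [lia|exact Hi].
      * intros [i [Hik [H1 H2]]]; apply H2, (HQ i (S i) k); [lia|tauto|tauto].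
    + apply Rle_trans with (chi (exists i, (i < k)%nat /\ Q i /\ ~ Q (S i))); [lra|].
      apply ind_le; intros [i [Hik Hi']]; exists i; split; [lia|exact Hi']. }
apply Rle_trans with (1 := H n), ind_bounds.
Qed.

(** * Area as a limit of lattice counts *)

Lemma Rabs_bounds (a b : R) : Rabs a <= b -> - b <= a <= b.
Proof. unfold Rabs; destruct (Rcase_abs a); lra. Qed.

(* [lat M k] enumerates the multiples of [step k] in [[-M, M]]. *)
Definition step (k : nat) : R := / INR (S k).
Definition lat (M k i : nat) : R := - INR M + INR i * step k.
Definition lsize (M k : nat) : nat := S (2 * M * S k).
(** The Riemann sum of f over the square [-M, M]^2 with mesh [step k]. *)
Definition lsum (M k : nat) (f : pt -> R) : R :=
  step k * step k *
  nsum (lsize M k) (fun i => nsum (lsize M k) (fun j => f (lat M k i, lat M k j))).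
Definition cnt (M k : nat) (K : region) : R := lsum M k (fun p => chi (K p)).

Definition in_box (M : nat) (K : region) : Prop :=
  forall p, K p -> Rabs (fst p) <= INR M /\ Rabs (snd p) <= INR M.

Lemma step_pos (k : nat) : 0 < step k.
Proof. apply Rinv_0_lt_compat, lt_0_INR; lia. Qed.

Lemma step_le1 (k : nat) : step k <= 1.
Proof.
unfold step; rewrite <- Rinv_1; apply Rinv_le_contravar; [lra|].
rewrite S_INR; pose proof (pos_INR k); lra.
Qed.

Lemma lsize_step (M k : nat) : INR (lsize M k) * step k = 2 * INR M + step k.
Proof.
unfold lsize, step; rewrite S_INR, !mult_INR; simpl (INR 2).
field; apply not_0_INR; lia.
Qed.

Lemma lsum_le (M k : nat) (f g : pt -> R) :
  (forall p, f p <= g p) -> lsum M k f <= lsum M k g.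
Proof.
intros H; unfold lsum; apply Rmult_le_compat_l.
- pose proof (step_pos k); nra.
- apply nsum_le; intros; apply nsum_le; intros; apply H.
Qed.

Lemma lsum_plus (M k : nat) (f g : pt -> R) :
  lsum M k (fun p => f p + g p) = lsum M k f + lsum M k g.
Proof.
unfold lsum; rewrite <- Rmult_plus_distr_l, <- nsum_plus; f_equal.
apply nsum_ext; intros; apply nsum_plus.
Qed.

Lemma lsum_scal (M k : nat) (c : R) (f : pt -> R) :
  lsum M k (fun p => c * f p) = c * lsum M k f.
Proof.
unfold lsum; rewrite (nsum_ext _ _
  (fun i => c * nsum (lsize M k) (fun j => f (lat M k i, lat M k j)))).
- rewrite nsum_scal; ring.
- intros; apply nsum_scal.
Qed.

Lemma lsum_nsum (M k n : nat) (F : nat -> pt -> R) :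
  lsum M k (fun p => nsum n (fun i => F i p)) = nsum n (fun i => lsum M k (F i)).
Proof.
induction n as [|n IH]; simpl.
- unfold lsum; rewrite (nsum_ext _ _ (fun _ => 0)), nsum_const; [ring|].
  intros; rewrite nsum_const; ring.
- rewrite lsum_plus, IH; reflexivity.
Qed.

Lemma cnt_nonneg (M k : nat) (K : region) : 0 <= cnt M k K.
Proof.
unfold cnt, lsum; apply Rmult_le_pos.
- pose proof (step_pos k); nra.
- apply nsum_nonneg; intros; apply nsum_nonneg; intros; apply ind_bounds.
Qed.

Lemma cnt_le (M k : nat) (K L : region) :
  (forall p, K p -> L p) -> cnt M k K <= cnt M k L.
Proof. intros H; apply lsum_le; intros p; apply ind_le, H. Qed.

Lemma lsum_prod (M k : nat) (f g : R -> R) :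
  lsum M k (fun p => f (fst p) * g (snd p)) =
  nsum (lsize M k) (fun i => step k * f (lat M k i)) *
  nsum (lsize M k) (fun i => step k * g (lat M k i)).
Proof.
unfold lsum; cbn [fst snd].
rewrite (nsum_ext _ _ (fun i => nsum (lsize M k) (fun j => g (lat M k j)) * f (lat M k i))).
- rewrite !nsum_scal; ring.
- intros i _; rewrite nsum_scal; ring.
Qed.

Lemma cnt_bound (M k : nat) (K : region) : cnt M k K <= (2 * INR M + 1) * (2 * INR M + 1).
Proof.
apply Rle_trans with (lsum M k (fun p => (fun _ => 1) (fst p) * (fun _ => 1) (snd p))).
- apply lsum_le; intros p; pose proof (ind_bounds (K p)); lra.
- rewrite (lsum_prod M k (fun _ => 1) (fun _ => 1)); cbv beta; rewrite nsum_const, Rmult_1_r, lsize_step.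
  pose proof (step_pos k); pose proof (step_le1 k); pose proof (pos_INR M).
  apply Rmult_le_compat; lra.
Qed.

(** Half-open, so that rectangles with disjoint interiors share no lattice point. *)
Definition half_open (r : rect) (p : pt) : Prop :=
  rx0 r <= fst p < rx1 r /\ ry0 r <= snd p < ry1 r.

(** The count is a product of two one-dimensional counts, each at least the side minus one mesh
    width. If a side is shorter than the mesh, the error term alone exceeds the area. *)
Lemma half_open_cnt (M k : nat) (r : rect) :
  rect_ok r -> in_box M (in_rect r) ->
  rect_area r <= cnt M k (half_open r)
                 + step k * ((rx1 r - rx0 r) + (ry1 r - ry0 r)).
Proof.
intros [Hx Hy] Hb.
destruct (Hb (rx0 r, ry0 r)) as [H1 H2]; [unfold in_rect; simpl; lra|].
destruct (Hb (rx1 r, ry1 r)) as [H3 H4]; [unfold in_rect; simpl; lra|].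
simpl in *.
apply Rabs_bounds in H1; apply Rabs_bounds in H2; apply Rabs_bounds in H3; apply Rabs_bounds in H4.
pose proof (step_pos k) as Hd.
pose proof (lsize_step M k) as Hl.
pose proof (count_lower (- INR M) (step k) (rx0 r) (rx1 r) (lsize M k) Hd
  ltac:(lra) ltac:(lra)) as HX.
pose proof (count_lower (- INR M) (step k) (ry0 r) (ry1 r) (lsize M k) Hd
  ltac:(lra) ltac:(lra)) as HY.
assert (E : cnt M k (half_open r) =
  nsum (lsize M k) (fun i => step k * chi (rx0 r <= lat M k i < rx1 r)) *
  nsum (lsize M k) (fun i => step k * chi (ry0 r <= lat M k i < ry1 r))).
{ rewrite <- (lsum_prod M k (fun x => chi (rx0 r <= x < rx1 r)) (fun y => chi (ry0 r <= y < ry1 r))).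
  apply Rle_antisym; apply lsum_le; intros p; unfold half_open;
  ind_split (rx0 r <= fst p < rx1 r); ind_split (ry0 r <= snd p < ry1 r);
  rewrite ?(ind_true (_ /\ _)) by tauto; rewrite ?(ind_false (_ /\ _)) by tauto; lra. }
rewrite E; unfold lat.
set (X := nsum _ _) in *; set (Y := nsum (lsize M k) (fun i => step k * chi (ry0 r <= _ < _))) in *.
assert (0 <= X) by (apply nsum_nonneg; intros i _;
  pose proof (ind_bounds (rx0 r <= - INR M + INR i * step k < rx1 r)); nra).
assert (0 <= Y) by (apply nsum_nonneg; intros i _;
  pose proof (ind_bounds (ry0 r <= - INR M + INR i * step k < ry1 r)); nra).
unfold rect_area.
set (w := rx1 r - rx0 r) in *; set (h := ry1 r - ry0 r) in *.
assert (0 <= w) by (unfold w; lra). assert (0 <= h) by (unfold h; lra).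
assert (0 <= X * Y) by nra.
destruct (Rle_lt_dec w (step k)); [nra|].
destruct (Rle_lt_dec h (step k)); [nra|].
assert ((w - step k) * (h - step k) <= X * Y) by (apply Rmult_le_compat; lra).
nra.
Qed.

Lemma half_open_sum (l : list rect) (p : pt) :
  pairwise_disjoint l ->
  fold_right (fun r acc => chi (half_open r p) + acc) 0 l
  <= chi (exists r, In r l /\ half_open r p).
Proof.
induction l as [|r l IH]; simpl; intros H; [apply ind_bounds|].
destruct H as [Hr Hl]; specialize (IH Hl).
ind_split (half_open r p).
- rewrite (ind_false (exists s, In s l /\ half_open s p)) in IH.
  + rewrite ind_true; [lra|]. exists r; tauto.
  + intros [s [Hs Hsp]]; specialize (Hr s Hs).
    unfold half_open, interior_disjoint in *; lra.
- apply Rle_trans with (chi (exists s, In s l /\ half_open s p)); [lra|].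
  apply ind_le; intros [s [H1 H2]]; exists s; tauto.
Qed.

Definition half_perimeter (l : list rect) : R :=
  fold_right (fun r acc => (rx1 r - rx0 r) + (ry1 r - ry0 r) + acc) 0 l.

(** For a fixed packing the error vanishes with the mesh, so the counts are asymptotically at least
    every inner sum. *)
Lemma packing_cnt (M k : nat) (K : region) (l : list rect) :
  in_box M K ->
  (forall r, In r l -> rect_ok r /\ (forall p, in_rect r p -> K p)) ->
  pairwise_disjoint l ->
  fold_right (fun r acc => rect_area r + acc) 0 l
  <= cnt M k K + step k * half_perimeter l.
Proof.
intros HM Hl Hd.
apply Rle_trans with
  (lsum M k (fun p => fold_right (fun r acc => chi (half_open r p) + acc) 0 l)
   + step k * half_perimeter l).
- clear Hd; induction l as [|r l IH]; simpl.
  + unfold lsum; rewrite (nsum_ext _ _ (fun _ => 0)), nsum_const; [lra|].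
    intros; rewrite nsum_const; ring.
  + rewrite (lsum_plus M k (fun p => chi (half_open r p))).
    assert (rect_area r <= cnt M k (half_open r)
                 + step k * ((rx1 r - rx0 r) + (ry1 r - ry0 r))).
    { destruct (Hl r) as [H1 H2]; [now left|].
      apply half_open_cnt; [exact H1|]. intros p Hp; apply HM, H2, Hp. }
    unfold cnt in H.
    specialize (IH (fun s Hs => Hl s (or_intror Hs))).
    change (half_perimeter (r :: l)) with
      ((rx1 r - rx0 r) + (ry1 r - ry0 r) + half_perimeter l).
    lra.
- apply Rplus_le_compat_r, lsum_le; intros p.
  apply Rle_trans with (1 := half_open_sum l p Hd), ind_le.
  intros [r [Hr [H1 H2]]]; apply (proj2 (Hl r Hr)); unfold in_rect; lra.
Qed.

(** The mesh squares contained in K form an explicit packing; comparing their number with the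
    lattice points of K bounds the counts from above. *)
Definition cell (M k i j : nat) : rect :=
  mkRect (lat M k i) (lat M k (S i)) (lat M k j) (lat M k (S j)).
Definition cell_in (M k : nat) (K : region) (i j : nat) : Prop :=
  forall p, in_rect (cell M k i j) p -> K p.

Fixpoint row_cells (M k : nat) (K : region) (i m : nat) : list rect :=
  match m with
  | O => nil
  | S j => if excluded_middle_informative (cell_in M k K i j)
           then cell M k i j :: row_cells M k K i j else row_cells M k K i j
  end.
Fixpoint all_cells (M k : nat) (K : region) (n m : nat) : list rect :=
  match n with
  | O => nil
  | S i => row_cells M k K i m ++ all_cells M k K i m
  end.

Lemma lat_S (M k i : nat) : lat M k (S i) = lat M k i + step k.
Proof. unfold lat; rewrite S_INR; ring. Qed.

Lemma lat_le (M k i j : nat) : (i <= j)%nat -> lat M k i <= lat M k j.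
Proof.
intros H; unfold lat; apply le_INR in H; pose proof (step_pos k); nra.
Qed.

Lemma row_cells_spec (M k : nat) (K : region) (i m : nat) (r : rect) :
  In r (row_cells M k K i m) ->
  exists j, (j < m)%nat /\ cell_in M k K i j /\ r = cell M k i j.
Proof.
induction m as [|m IH]; simpl; [tauto|].
destruct (excluded_middle_informative _) as [H|H].
- intros [E|E]; [exists m; auto|].
  destruct (IH E) as [j [H1 H2]]; exists j; split; [lia|exact H2].
- intros E; destruct (IH E) as [j [H1 H2]]; exists j; split; [lia|exact H2].
Qed.

Lemma all_cells_spec (M k : nat) (K : region) (n m : nat) (r : rect) :
  In r (all_cells M k K n m) ->
  exists i j, (i < n)%nat /\ cell_in M k K i j /\ r = cell M k i j.
Proof.
induction n as [|n IH]; simpl; [tauto|].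
intros H; apply in_app_or in H; destruct H as [H|H].
- apply row_cells_spec in H; destruct H as [j [H1 H2]]; exists n, j; split; [lia|exact H2].
- destruct (IH H) as [i [j [H1 H2]]]; exists i, j; split; [lia|exact H2].
Qed.

Lemma pairwise_disjoint_app (l l' : list rect) :
  pairwise_disjoint l -> pairwise_disjoint l' ->
  (forall r s, In r l -> In s l' -> interior_disjoint r s) ->
  pairwise_disjoint (l ++ l').
Proof.
induction l as [|r l IH]; simpl; [tauto|].
intros [H1 H2] H3 H4; split.
- intros s Hs; apply in_app_or in Hs; destruct Hs as [Hs|Hs]; auto.
- apply IH; auto.
Qed.

Lemma all_cells_disjoint (M k : nat) (K : region) (n m : nat) :
  pairwise_disjoint (all_cells M k K n m).
Proof.
induction n as [|n IH]; simpl; [exact I|].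
apply pairwise_disjoint_app; [|exact IH|].
- clear IH; induction m as [|m IH]; simpl; [exact I|].
  destruct (excluded_middle_informative _) as [H|H]; [|exact IH].
  split; [|exact IH].
  intros s Hs; apply row_cells_spec in Hs; destruct Hs as [j [H1 [_ ->]]].
  right; right; right; simpl; apply lat_le; lia.
- intros r s Hr Hs; apply row_cells_spec in Hr; apply all_cells_spec in Hs.
  destruct Hr as [j [_ [_ ->]]]; destruct Hs as [i [j' [Hi [_ ->]]]].
  right; left; simpl; apply lat_le; lia.
Qed.

Lemma area_sum_app (l l' : list rect) :
  fold_right (fun r acc => rect_area r + acc) 0 (l ++ l') =
  fold_right (fun r acc => rect_area r + acc) 0 l +
  fold_right (fun r acc => rect_area r + acc) 0 l'.
Proof. induction l as [|r l IH]; simpl; [|rewrite IH]; ring. Qed.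

Lemma all_cells_area (M k : nat) (K : region) (n m : nat) :
  fold_right (fun r acc => rect_area r + acc) 0 (all_cells M k K n m) =
  step k * step k * nsum n (fun i => nsum m (fun j => chi (cell_in M k K i j))).
Proof.
induction n as [|n IH]; simpl; [ring|].
rewrite area_sum_app, IH, Rmult_plus_distr_l, Rplus_comm; f_equal.
clear IH; induction m as [|m IH]; simpl; [ring|].
unfold chi at 2; destruct (excluded_middle_informative _) as [H|H]; simpl; rewrite IH;
  [|ring].
unfold rect_area, cell; simpl; rewrite !lat_S; ring.
Qed.

Definition row_exit (M k : nat) (K : region) (i j : nat) : Prop :=
  K (lat M k i, lat M k j) /\ ~ K (lat M k (S i), lat M k j).
Definition col_exit (M k : nat) (K : region) (i j : nat) : Prop :=
  K (lat M k i, lat M k j) /\ ~ K (lat M k i, lat M k (S j)).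

Lemma segment_between (a b c : R) :
  a <= c <= b -> exists l, 0 <= l <= 1 /\ c = l * a + (1 - l) * b.
Proof.
intros H; destruct (Req_dec a b) as [E|E].
- exists 0; lra.
- exists ((b - c) / (b - a)); split.
  + assert (0 < / (b - a)) by (apply Rinv_0_lt_compat; lra).
    assert ((b - a) * / (b - a) = 1) by (apply Rinv_r; lra).
    unfold Rdiv; split; nra.
  + field; lra.
Qed.

Lemma convex_row (K : region) (a b c y : R) :
  convex_set K -> a <= c <= b -> K (a, y) -> K (b, y) -> K (c, y).
Proof.
intros HK Hc Ha Hb; destruct (segment_between a b c Hc) as [l [Hl ->]].
pose proof (HK _ _ l Ha Hb Hl) as H; simpl in H.
now replace (l * y + (1 - l) * y) with y in H by ring.
Qed.

Lemma convex_col (K : region) (a b c x : R) :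
  convex_set K -> a <= c <= b -> K (x, a) -> K (x, b) -> K (x, c).
Proof.
intros HK Hc Ha Hb; destruct (segment_between a b c Hc) as [l [Hl ->]].
pose proof (HK _ _ l Ha Hb Hl) as H; simpl in H.
now replace (l * x + (1 - l) * x) with x in H by ring.
Qed.

(* A lattice point of K whose cell is not contained in K is, up to a shift, the last one
   of K in its row or column, so that such cells are negligible. *)
Lemma cell_ind (M k : nat) (K : region) (i j : nat) :
  convex_set K ->
  chi (K (lat M k i, lat M k j)) <=
  chi (cell_in M k K i j) + chi (row_exit M k K i j) + chi (col_exit M k K i j)
  + chi (row_exit M k K i (S j)).
Proof.
intros HK.
pose proof (ind_bounds (cell_in M k K i j)).
pose proof (ind_bounds (row_exit M k K i j)).
pose proof (ind_bounds (col_exit M k K i j)).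
pose proof (ind_bounds (row_exit M k K i (S j))).
ind_split (K (lat M k i, lat M k j)); [|lra].
ind_split (K (lat M k (S i), lat M k j));
  [|rewrite (ind_true (row_exit M k K i j)) in * by (split; assumption); lra].
ind_split (K (lat M k i, lat M k (S j)));
  [|rewrite (ind_true (col_exit M k K i j)) in * by (split; assumption); lra].
ind_split (K (lat M k (S i), lat M k (S j)));
  [|rewrite (ind_true (row_exit M k K i (S j))) in * by (split; assumption); lra].
enough (chi (cell_in M k K i j) = 1) by lra.
apply ind_true; intros [x y] [Hx Hy]; simpl in *.
apply convex_col with (lat M k j) (lat M k (S j)); [exact HK|exact Hy| |];
  apply convex_row with (lat M k i) (lat M k (S i)); assumption.
Qed.

(** By convexity each row and each column has at most one exit, so the three families of exits
    contribute at most 3 [lsize M k] points, of weight [step k] squared each. *)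
Lemma cnt_cells (M k : nat) (K : region) :
  convex_set K ->
  cnt M k K <= step k * step k *
    nsum (lsize M k) (fun i => nsum (lsize M k) (fun j => chi (cell_in M k K i j)))
  + step k * (3 * (2 * INR M + 1)).
Proof.
intros HK.
pose proof (step_pos k) as Hd.
set (n := lsize M k).
assert (Hrow : forall j, nsum n (fun i => chi (row_exit M k K i j)) <= 1).
{ intros j; apply (exit_count n (fun i => K (lat M k i, lat M k j))).
  intros a c b Hc Ha Hb; apply convex_row with (lat M k a) (lat M k b); auto.
  split; apply lat_le; lia. }
assert (Hcol : forall i, nsum n (fun j => chi (col_exit M k K i j)) <= 1).
{ intros i; apply (exit_count n (fun j => K (lat M k i, lat M k j))).
  intros a c b Hc Ha Hb; apply convex_col with (lat M k a) (lat M k b); auto.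
  split; apply lat_le; lia. }
assert (H : nsum n (fun i => nsum n (fun j => chi (K (lat M k i, lat M k j)))) <=
  nsum n (fun i => nsum n (fun j => chi (cell_in M k K i j)))
  + 3 * INR n).
{ apply Rle_trans with (nsum n (fun i => nsum n (fun j =>
    chi (cell_in M k K i j) + chi (row_exit M k K i j) + chi (col_exit M k K i j)
    + chi (row_exit M k K i (S j))))).
  - apply nsum_le; intros; apply nsum_le; intros; now apply cell_ind.
  - rewrite (nsum_ext n _ (fun i => nsum n (fun j => chi (cell_in M k K i j))
      + nsum n (fun j => chi (row_exit M k K i j))
      + nsum n (fun j => chi (col_exit M k K i j))
      + nsum n (fun j => chi (row_exit M k K i (S j))))).
    2: { intros i _; rewrite <- !nsum_plus; reflexivity. }
    rewrite !nsum_plus.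
    rewrite (nsum_swap n n (fun i j => chi (row_exit M k K i j))).
    rewrite (nsum_swap n n (fun i j => chi (row_exit M k K i (S j)))).
    pose proof (nsum_le n _ (fun _ => 1) (fun j _ => Hrow j)) as H1.
    pose proof (nsum_le n _ (fun _ => 1) (fun j _ => Hrow (S j))) as H2.
    pose proof (nsum_le n _ (fun _ => 1) (fun i _ => Hcol i)) as H3.
    rewrite nsum_const in H1, H2, H3; lra. }
unfold cnt, lsum; fold n.
apply Rle_trans with (step k * step k *
  (nsum n (fun i => nsum n (fun j => chi (cell_in M k K i j))) + 3 * INR n)).
- apply Rmult_le_compat_l; [nra|exact H].
- pose proof (lsize_step M k) as Hl; fold n in Hl.
  pose proof (step_le1 k).
  rewrite Rmult_plus_distr_l; apply Rplus_le_compat_l.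
  replace (step k * step k * (3 * INR n)) with (step k * (3 * (INR n * step k))) by ring.
  rewrite Hl; apply Rmult_le_compat_l; lra.
Qed.

Lemma step_cv (c : R) : Un_cv (fun k => step k * c) 0.
Proof.
intros eps He.
destruct (archimed_cor1 (eps / (Rabs c + 1))) as [N [HN HN0]].
- apply Rdiv_lt_0_compat; [lra|]. pose proof (Rabs_pos c); lra.
- exists N; intros k Hk; unfold Rdist.
  rewrite Rminus_0_r, Rabs_mult, (Rabs_pos_eq (step k)) by (left; apply step_pos).
  assert (step k <= / INR N).
  { apply Rinv_le_contravar; [now apply lt_0_INR|apply le_INR; lia]. }
  pose proof (Rabs_pos c); pose proof (step_pos k).
  apply Rle_lt_trans with (/ INR N * (Rabs c + 1)); [nra|].
  apply Rlt_le_trans with (eps / (Rabs c + 1) * (Rabs c + 1)).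
  + apply Rmult_lt_compat_r; lra.
  + right; field; lra.
Qed.

Lemma cv_const (c : R) : Un_cv (fun _ => c) c.
Proof. intros eps He; exists 0%nat; intros; unfold Rdist; rewrite Rminus_diag, Rabs_R0; lra. Qed.

Lemma cv_plus_step (u : nat -> R) (l c : R) :
  Un_cv u l -> Un_cv (fun k => u k + step k * c) l.
Proof.
intros H; rewrite <- (Rplus_0_r l); apply CV_plus; [exact H|apply step_cv].
Qed.

(** [area] is a choice, determined only once a least upper bound is known to exist. The inner sums
    are bounded because the counts are bounded by that of the box at every mesh. *)
Lemma area_lub (M : nat) (K : region) :
  in_box M K -> is_lub (inner_sums K) (area K).
Proof.
intros HM; unfold area; apply epsilon_spec.
destruct (completeness (inner_sums K)) as [m Hm].
- exists ((2 * INR M + 1) * (2 * INR M + 1)); intros a [l [H1 [H2 ->]]].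
  set (C := (2 * INR M + 1) * (2 * INR M + 1)).
  eapply Rle_cv_lim; [|apply cv_const|
    apply (cv_plus_step (fun _ => C) C (half_perimeter l)), cv_const].
  intros k; cbv beta; apply Rle_trans with (1 := packing_cnt M k K l HM H1 H2).
  apply Rplus_le_compat_r, cnt_bound.
- exists 0, nil; simpl; repeat split; tauto.
- exists m; exact Hm.
Qed.

(** A nearly optimal fixed packing bounds the counts from below, the packing by mesh squares bounds
    them from above. *)
Theorem cnt_cv_area (M : nat) (K : region) :
  in_box M K -> convex_set K -> Un_cv (fun k => cnt M k K) (area K).
Proof.
intros HM HK; destruct (area_lub M K HM) as [Hub Hlub].
intros eps He.
assert (Hex : exists l, (forall r, In r l -> rect_ok r /\ (forall p, in_rect r p -> K p)) /\
    pairwise_disjoint l /\ area K - eps / 2 < fold_right (fun r acc => rect_area r + acc) 0 l).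
{ apply NNPP; intros Hn.
  assert (area K <= area K - eps / 2); [|lra].
  apply Hlub; intros a [l [H1 [H2 ->]]].
  apply Rnot_lt_le; intros H3; apply Hn; exists l; auto. }
destruct Hex as [l [H1 [H2 H3]]].
destruct (step_cv (half_perimeter l) (eps / 2)) as [N1 HN1]; [lra|].
destruct (step_cv (3 * (2 * INR M + 1)) (eps / 2)) as [N2 HN2]; [lra|].
exists (Nat.max N1 N2); intros k Hk.
specialize (HN1 k ltac:(lia)); specialize (HN2 k ltac:(lia)).
unfold Rdist in *; rewrite Rminus_0_r in HN1, HN2.
apply Rabs_def2 in HN1; apply Rabs_def2 in HN2.
pose proof (packing_cnt M k K l HM H1 H2).
pose proof (cnt_cells M k K HK) as Hc.
rewrite <- all_cells_area in Hc.
assert (fold_right (fun r acc => rect_area r + acc) 0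
  (all_cells M k K (lsize M k) (lsize M k)) <= area K).
{ apply Hub; exists (all_cells M k K (lsize M k) (lsize M k)).
  split; [|split; [apply all_cells_disjoint|reflexivity]].
  intros r Hr; apply all_cells_spec in Hr; destruct Hr as [i [j [_ [Hc' ->]]]].
  split; [|exact Hc'].
  split; simpl; apply lat_le; lia. }
apply Rabs_def1; lra.
Qed.

(** * Areas of half-plane sections *)

(** Unlike [convex_body], this is stable under intersection with open half-planes. The common box
    lets A, B and their pieces be counted on one lattice. *)
Definition tame (M : nat) (K : region) : Prop := in_box M K /\ convex_set K.

Definition comb (l : R) (p q : pt) : pt :=
  (l * fst p + (1 - l) * fst q, l * snd p + (1 - l) * snd q).

Definition aff (a b c : R) (p : pt) : R := a * fst p + b * snd p - c.
Definition affine (f : pt -> R) : Prop := exists a b c, forall p, f p = aff a b c p.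

Definition le0 (f : pt -> R) : region := fun p => f p <= 0.
Definition lt0 (f : pt -> R) : region := fun p => f p < 0.
Definition gt0 (f : pt -> R) : region := fun p => 0 < f p.

Lemma affine_aff (a b c : R) : affine (aff a b c).
Proof. now exists a, b, c. Qed.

Lemma affine_opp (f : pt -> R) : affine f -> affine (fun p => - f p).
Proof.
intros [a [b [c H]]]; exists (- a), (- b), (- c); intros p; rewrite H; unfold aff; ring.
Qed.

Lemma affine_comb (f : pt -> R) (l : R) (p q : pt) :
  affine f -> f (comb l p q) = l * f p + (1 - l) * f q.
Proof. intros [a [b [c H]]]; rewrite !H; unfold aff, comb; simpl; ring. Qed.

Lemma region_ext (K L : region) : (forall p, K p <-> L p) -> K = L.
Proof.
intros H; apply functional_extensionality; intros p.
apply propositional_extensionality, H.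
Qed.

Lemma convex_le0 (f : pt -> R) : affine f -> convex_set (le0 f).
Proof.
intros Hf p q l Hp Hq Hl; unfold le0 in *; fold (comb l p q).
rewrite affine_comb by exact Hf; nra.
Qed.

Lemma convex_lt0 (f : pt -> R) : affine f -> convex_set (lt0 f).
Proof.
intros Hf p q l Hp Hq Hl; unfold lt0 in *; fold (comb l p q).
rewrite affine_comb by exact Hf; nra.
Qed.

Lemma convex_gt0 (f : pt -> R) : affine f -> convex_set (gt0 f).
Proof.
intros Hf p q l Hp Hq Hl; unfold gt0 in *; fold (comb l p q).
rewrite affine_comb by exact Hf; nra.
Qed.

Lemma tame_inter (M : nat) (H K : region) : convex_set H -> tame M K -> tame M (inter H K).
Proof.
intros HH [HM HK]; split.
- intros p [_ Hp]; now apply HM.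
- intros p q l [Hp1 Hp2] [Hq1 Hq2] Hl; split; [now apply HH|now apply HK].
Qed.

Lemma tame_le0 (M : nat) (f : pt -> R) (K : region) :
  affine f -> tame M K -> tame M (inter (le0 f) K).
Proof. intros Hf; now apply tame_inter, convex_le0. Qed.

Lemma tame_lt0 (M : nat) (f : pt -> R) (K : region) :
  affine f -> tame M K -> tame M (inter (lt0 f) K).
Proof. intros Hf; now apply tame_inter, convex_lt0. Qed.

Lemma tame_gt0 (M : nat) (f : pt -> R) (K : region) :
  affine f -> tame M K -> tame M (inter (gt0 f) K).
Proof. intros Hf; now apply tame_inter, convex_gt0. Qed.

Lemma tame_cv (M : nat) (K : region) : tame M K -> Un_cv (fun k => cnt M k K) (area K).
Proof. intros [H1 H2]; now apply cnt_cv_area. Qed.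

Lemma area_nonneg (M : nat) (K : region) : tame M K -> 0 <= area K.
Proof.
intros HK; eapply Rle_cv_lim; [|apply cv_const|apply (tame_cv M), HK].
intros k; apply cnt_nonneg.
Qed.

Lemma area_mono (M : nat) (K L : region) :
  tame M K -> tame M L -> (forall p, K p -> L p) -> area K <= area L.
Proof.
intros HK HL H; eapply Rle_cv_lim; [|apply (tame_cv M), HK|apply (tame_cv M), HL].
intros k; now apply cnt_le.
Qed.

Lemma area_cover (M : nat) (K S T : region) :
  tame M K -> tame M S -> tame M T ->
  (forall p, K p -> S p \/ T p) -> area K <= area S + area T.
Proof.
intros HK HS HT H; eapply Rle_cv_lim; [|apply (tame_cv M), HK|
  apply CV_plus; [apply (tame_cv M), HS|apply (tame_cv M), HT]].
intros k; cbv beta; unfold cnt; rewrite <- lsum_plus; apply lsum_le; intros p.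
pose proof (ind_bounds (S p)); pose proof (ind_bounds (T p)).
ind_split (K p); [|lra].
destruct (H p Hi) as [H'|H']; rewrite (ind_true _ H') in *; lra.
Qed.

Lemma area_pack (M : nat) (K S T : region) :
  tame M K -> tame M S -> tame M T ->
  (forall p, S p -> K p) -> (forall p, T p -> K p) -> (forall p, S p -> T p -> False) ->
  area S + area T <= area K.
Proof.
intros HK HS HT H1 H2 H3; eapply Rle_cv_lim; [|
  apply CV_plus; [apply (tame_cv M), HS|apply (tame_cv M), HT]|apply (tame_cv M), HK].
intros k; cbv beta; unfold cnt; rewrite <- lsum_plus; apply lsum_le; intros p.
pose proof (ind_bounds (K p)).
ind_split (S p); ind_split (T p); try lra.
- destruct (H3 p Hi Hi0).
- rewrite (ind_true _ (H1 p Hi)); lra.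
- rewrite (ind_true _ (H2 p Hi0)); lra.
Qed.

Lemma area_split (M : nat) (K : region) (f : pt -> R) :
  affine f -> tame M K ->
  area K = area (inter (le0 f) K) + area (inter (gt0 f) K).
Proof.
intros Hf HK; apply Rle_antisym.
- apply (area_cover M); auto using tame_le0, tame_gt0.
  intros p Hp; unfold inter, le0, gt0.
  destruct (Rle_or_lt (f p) 0); tauto.
- apply (area_pack M); auto using tame_le0, tame_gt0; unfold inter, le0, gt0;
    intros p; intros; intuition lra.
Qed.

(** One coordinate of the unit normal is at least 1/2 in absolute value. Lattice lines parallel to
    that axis meet the strip in intervals of length at most 2 e, hence in at most 2 e / [step k] + 1
    lattice points each. *)
Lemma cnt_strip (M k : nat) (a b c e : R) :
  a * a + b * b = 1 -> 0 <= e ->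
  cnt M k (fun p => c <= a * fst p + b * snd p <= c + e)
  <= (2 * INR M + 1) * (2 * e + step k).
Proof.
intros Hab He.
pose proof (step_pos k) as Hd; pose proof (step_le1 k) as Hd1; pose proof (pos_INR M) as HM.
assert (Hline : forall u v t, 1 / 2 <= Rabs v ->
  nsum (lsize M k) (fun j => step k *
    chi (c <= u * t + v * lat M k j <= c + e)) <= 2 * e + step k).
{ intros u v t Hv.
  assert (Hv0 : v <> 0) by (intros ->; rewrite Rabs_R0 in Hv; lra).
  assert (He' : e / Rabs v <= 2 * e).
  { apply Rmult_le_reg_r with (Rabs v); [lra|].
    unfold Rdiv; rewrite Rmult_assoc, Rinv_l by lra; nra. }
  assert (0 <= e / Rabs v) by (apply Rle_mult_inv_pos; lra).
  set (x0 := if Rle_dec 0 v then (c - u * t) / v else (c + e - u * t) / v).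
  apply Rle_trans with (nsum (lsize M k) (fun j => step k *
    chi (x0 <= - INR M + INR j * step k <= x0 + e / Rabs v))).
  - apply nsum_le; intros j _; apply Rmult_le_compat_l; [lra|].
    apply ind_le; fold (lat M k j); generalize (lat M k j); intros y Hy.
    unfold x0, Rabs in *; destruct (Rle_dec 0 v); destruct (Rcase_abs v); try lra.
    + assert (0 < / v) by (apply Rinv_0_lt_compat; lra).
      replace y with ((v * y) * / v) by (field; lra).
      unfold Rdiv; split; nra.
    + assert (0 < / - v) by (apply Rinv_0_lt_compat; lra).
      replace y with ((- v * y) * / - v) by (field; lra).
      replace ((c + e - u * t) / v) with ((u * t - c - e) * / - v) by (field; lra).
      unfold Rdiv; split; nra.
  - pose proof (count_upper (- INR M) (step k) x0 (x0 + e / Rabs v) (lsize M k) Hd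
      ltac:(lra)); lra. }
unfold cnt, lsum; cbn [fst snd].
set (n := lsize M k) in *.
assert (Hsum : forall g : nat -> nat -> R,
  (forall i, nsum n (fun j => step k * g i j) <= 2 * e + step k) ->
  step k * step k * nsum n (fun i => nsum n (fun j => g i j))
  <= (2 * INR M + 1) * (2 * e + step k)).
{ intros g Hg.
  replace (step k * step k * nsum n (fun i => nsum n (fun j => g i j)))
    with (step k * nsum n (fun i => nsum n (fun j => step k * g i j))).
  - apply Rle_trans with (step k * nsum n (fun _ => 2 * e + step k)).
    + apply Rmult_le_compat_l; [lra|]; apply nsum_le; intros; apply Hg.
    + rewrite nsum_const, <- Rmult_assoc.
      apply Rmult_le_compat_r; [lra|].
      pose proof (lsize_step M k) as Hl; fold n in Hl; lra.
  - rewrite (nsum_ext n (fun i => nsum n (fun j => step k * g i j))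
      (fun i => step k * nsum n (fun j => g i j))).
    + rewrite nsum_scal; ring.
    + intros; apply nsum_scal. }
destruct (Rle_or_lt (1 / 2) (Rabs b)) as [Hb|Hb].
- apply Hsum; intros i; now apply (Hline a b).
- rewrite nsum_swap; apply Hsum; intros i.
  rewrite (nsum_ext n _ (fun j => step k *
    chi (c <= b * lat M k i + a * lat M k j <= c + e))).
  + apply (Hline b a).
    apply Rnot_lt_le; intros Ha.
    assert (Rabs a * Rabs a = a * a) by (rewrite <- Rabs_mult; apply Rabs_pos_eq; nra).
    assert (Rabs b * Rabs b = b * b) by (rewrite <- Rabs_mult; apply Rabs_pos_eq; nra).
    pose proof (Rabs_pos a); pose proof (Rabs_pos b); nra.
  + intros j _; now rewrite (Rplus_comm (b * _)).
Qed.

Definition lip (M : nat) : R := 2 * (2 * INR M + 1).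

(** In the box the two affine functions differ by at most e, so a point of the new half-plane that
    is not in the old one lies in a strip of width e along the old line. This Lipschitz bound serves
    both the intermediate value argument and the final limit of lines. *)
Lemma area_lip (M : nat) (K : region) (a b c a' b' c' : R) :
  tame M K -> a * a + b * b = 1 ->
  area (inter (le0 (aff a' b' c')) K) <=
  area (inter (le0 (aff a b c)) K)
  + lip M * (Rabs (c - c') + INR M * (Rabs (a - a') + Rabs (b - b'))).
Proof.
intros HK Hab.
set (e := Rabs (c - c') + INR M * (Rabs (a - a') + Rabs (b - b'))).
pose proof (pos_INR M) as HM.
assert (He : 0 <= e).
{ unfold e; pose proof (Rabs_pos (c - c')); pose proof (Rabs_pos (a - a'));
  pose proof (Rabs_pos (b - b')); nra. }
eapply Rle_cv_lim; [|apply (tame_cv M), tame_le0; [apply affine_aff|exact HK]|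
  apply CV_plus; [apply (tame_cv M), tame_le0; [apply affine_aff|exact HK]|
    apply (cv_plus_step (fun _ => lip M * e) _ (2 * INR M + 1)), cv_const]].
intros k; cbv beta.
apply Rle_trans with (cnt M k (inter (le0 (aff a b c)) K) +
  cnt M k (fun p => c <= a * fst p + b * snd p <= c + e)).
- unfold cnt; rewrite <- lsum_plus; apply lsum_le; intros p.
  pose proof (ind_bounds (c <= a * fst p + b * snd p <= c + e)).
  pose proof (ind_bounds (inter (le0 (aff a b c)) K p)).
  ind_split (inter (le0 (aff a' b' c')) K p); [|lra].
  destruct Hi as [Hp HKp]; unfold le0, aff in Hp.
  destruct (Rle_or_lt (a * fst p + b * snd p) c) as [Hc|Hc].
  + rewrite (ind_true (inter (le0 (aff a b c)) K p)); [lra|].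
    split; [unfold le0, aff; lra|exact HKp].
  + rewrite (ind_true (c <= a * fst p + b * snd p <= c + e)); [lra|].
    destruct (proj1 HK p HKp) as [Hx Hy].
    assert ((a - a') * fst p <= INR M * Rabs (a - a')).
    { apply Rle_trans with (1 := Rle_abs _); rewrite Rabs_mult.
      pose proof (Rabs_pos (a - a')); nra. }
    assert ((b - b') * snd p <= INR M * Rabs (b - b')).
    { apply Rle_trans with (1 := Rle_abs _); rewrite Rabs_mult.
      pose proof (Rabs_pos (b - b')); nra. }
    pose proof (Rle_abs (c' - c)). rewrite Rabs_minus_sym in H3.
    unfold e; lra.
- pose proof (cnt_strip M k a b c e Hab He); unfold lip; lra.
Qed.

Lemma affine_unit (f : pt -> R) (p q : pt) :
  affine f -> f p <> f q ->
  exists r a b c, 0 < r /\ a * a + b * b = 1 /\ forall z, f z = r * aff a b c z.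
Proof.
intros [a [b [c H]]] Hn.
assert (Hab : 0 < a * a + b * b).
{ assert (a <> 0 \/ b <> 0).
  { apply NNPP; intros H0; apply Hn; rewrite !H; unfold aff.
    replace a with 0 by (apply NNPP; intuition lra).
    replace b with 0 by (apply NNPP; intuition lra). ring. }
  destruct H0; nra. }
set (r := sqrt (a * a + b * b)).
assert (Hr : 0 < r) by now apply sqrt_lt_R0.
assert (Hr2 : r * r = a * a + b * b) by (apply sqrt_sqrt; lra).
exists r, (a / r), (b / r), (c / r); split; [exact Hr|split].
- replace (a / r * (a / r) + b / r * (b / r)) with ((a * a + b * b) / (r * r)) by (field; lra).
  rewrite <- Hr2; field; lra.
- intros z; rewrite H; unfold aff; field; lra.
Qed.

(** The points p and q witness that f is not constant; its zero line is then a strip of width 0 and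
    carries no area. *)
Lemma area_lt0 (M : nat) (K : region) (f : pt -> R) (p q : pt) :
  tame M K -> affine f -> f p <> f q ->
  area (inter (lt0 f) K) = area (inter (le0 f) K).
Proof.
intros HK Hf Hn; apply Rle_antisym.
- apply (area_mono M); auto using tame_le0, tame_lt0.
  intros z [H1 H2]; split; [unfold le0, lt0 in *; lra|exact H2].
- destruct (affine_unit f p q Hf Hn) as [r [a [b [c [Hr [Hab E]]]]]].
  eapply Rle_cv_lim; [|apply (tame_cv M), tame_le0; [exact Hf|exact HK]|
    apply (cv_plus_step (fun k => cnt M k (inter (lt0 f) K)) _ (2 * INR M + 1)),
      (tame_cv M), tame_lt0; [exact Hf|exact HK]].
  intros k; cbv beta.
  apply Rle_trans with (cnt M k (inter (lt0 f) K) +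
    cnt M k (fun p => c <= a * fst p + b * snd p <= c + 0)).
  + unfold cnt; rewrite <- lsum_plus; apply lsum_le; intros z.
    pose proof (ind_bounds (c <= a * fst z + b * snd z <= c + 0)).
    pose proof (ind_bounds (inter (lt0 f) K z)).
    ind_split (inter (le0 f) K z); [|lra].
    destruct Hi as [Hz HKz]; unfold le0 in Hz.
    destruct (Rle_lt_or_eq_dec _ _ Hz) as [Hz'|Hz'].
    * rewrite (ind_true (inter (lt0 f) K z)); [lra|now split].
    * rewrite (ind_true (c <= a * fst z + b * snd z <= c + 0)); [lra|].
      rewrite E in Hz'; unfold aff in Hz'.
      apply Rmult_integral in Hz'; lra.
  + pose proof (cnt_strip M k a b c 0 Hab (Rle_refl 0)); lra.
Qed.

Lemma area_opp (M : nat) (K : region) (f : pt -> R) (p q : pt) :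
  tame M K -> affine f -> f p <> f q ->
  area (inter (le0 (fun z => - f z)) K) = area K - area (inter (le0 f) K).
Proof.
intros HK Hf Hn.
rewrite (area_split M K f Hf HK), <- (area_lt0 M K (fun z => - f z) p q HK);
  [|now apply affine_opp|lra].
replace (inter (lt0 (fun z => - f z)) K) with (inter (gt0 f) K); [lra|].
apply region_ext; intros z; unfold inter, lt0, gt0; intuition lra.
Qed.

Lemma body_tame (K : region) : convex_body K -> exists M, tame M K.
Proof.
intros [_ [[B HB] [HK _]]].
destruct (INR_unbounded (B + 1)) as [M HM].
exists M; split; [|exact HK].
intros p Hp; specialize (HB p Hp); unfold dist2 in HB; simpl in HB.
split; apply Rabs_le; split; nra.
Qed.

Lemma area_interior (M : nat) (K : region) :
  tame M K -> nonempty_interior K -> 0 < area K.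
Proof.
intros [HM HK] [p [r [Hr H]]].
(* [dist2] is a squared distance: with s at most 1 and r / 4, points of the square of half-side s
   satisfy [dist2] <= 2 s^2 <= 2 s < r. *)
set (s := Rmin 1 (r / 4)).
assert (Hs : 0 < s <= 1) by (unfold s, Rmin; destruct (Rle_dec 1 (r / 4)); lra).
assert (Hsr : s <= r / 4) by apply Rmin_r.
apply Rlt_le_trans with (rect_area (mkRect (fst p - s) (fst p + s) (snd p - s) (snd p + s))).
- unfold rect_area; simpl; nra.
- apply (area_lub M K HM); exists (mkRect (fst p - s) (fst p + s) (snd p - s) (snd p + s) :: nil).
  split; [|split; [simpl; tauto|simpl; ring]].
  intros t [<-|[]]; split; [split; simpl; lra|].
  intros q [Hx Hy]; simpl in *; apply H; unfold dist2.
  assert ((fst p - fst q) ^ 2 <= s * s) by nra.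
  assert ((snd p - snd q) ^ 2 <= s * s) by nra.
  nra.
Qed.

Lemma affine_lower (M : nat) (f : pt -> R) :
  affine f -> exists F, 0 < F /\ forall K p, in_box M K -> K p -> - F <= f p.
Proof.
intros [a [b [c H]]].
exists (INR M * (Rabs a + Rabs b) + Rabs c + 1).
pose proof (pos_INR M); pose proof (Rabs_pos a); pose proof (Rabs_pos b); pose proof (Rabs_pos c).
split; [nra|].
intros K p HM Hp; rewrite H; unfold aff; destruct (HM p Hp) as [Hx Hy].
assert (- (INR M * Rabs a) <= a * fst p).
{ pose proof (Rle_abs (- (a * fst p))); rewrite Rabs_Ropp, Rabs_mult in H4; nra. }
assert (- (INR M * Rabs b) <= b * snd p).
{ pose proof (Rle_abs (- (b * snd p))); rewrite Rabs_Ropp, Rabs_mult in H5; nra. }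
pose proof (Rle_abs c); lra.
Qed.

(* Shrinking a ball of K towards w keeps it inside both open half-planes. *)
Lemma area_near (M : nat) (K : region) (f g : pt -> R) (w : pt) :
  tame M K -> nonempty_interior K -> affine f -> affine g ->
  K w -> 0 < f w -> 0 < g w ->
  0 < area (inter (gt0 f) (inter (gt0 g) K)).
Proof.
intros HK [o [r [Hr Ho]]] Hf Hg Hw Hfw Hgw.
apply (area_interior M); [auto using tame_gt0|].
destruct (affine_lower M f Hf) as [F [HF0 HF]].
destruct (affine_lower M g Hg) as [G [HG0 HG]].
set (m := Rmin (f w) (g w)).
assert (Hm : 0 < m) by (unfold m, Rmin; destruct (Rle_dec (f w) (g w)); lra).
(* With this choice (1 - e) m - e F = e G > 0, and symmetrically for g. The radius below carries e^2
   because it bounds a squared distance. *)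
set (e := m / (m + F + G)).
assert (He : 0 < e) by (apply Rdiv_lt_0_compat; lra).
assert (He' : e * (m + F + G) = m) by (unfold e; field; lra).
assert (e < 1) by nra.
exists (comb (1 - e) w o), (e * e * r); split; [apply Rmult_lt_0_compat; nra|].
intros q Hq.
set (o' := ((fst q - (1 - e) * fst w) / e, (snd q - (1 - e) * snd w) / e)).
assert (Eq : q = comb (1 - e) w o').
{ unfold comb, o'; destruct q; simpl; f_equal; field; lra. }
assert (Ho' : K o').
{ apply Ho; apply Rmult_lt_reg_l with (e * e); [nra|].
  apply Rle_lt_trans with (2 := Hq); right.
  unfold dist2, comb, o'; simpl; field; lra. }
pose proof (HF K o' (proj1 HK) Ho'); pose proof (HG K o' (proj1 HK) Ho').
assert (m <= f w) by apply Rmin_l. assert (m <= g w) by apply Rmin_r.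
rewrite Eq; split; [|split].
- unfold gt0; rewrite affine_comb by exact Hf; nra.
- unfold gt0; rewrite affine_comb by exact Hg; nra.
- apply (proj2 HK w o'); auto; lra.
Qed.

(** * Boundary points *)

(* Positive when z lies to the left of the line oriented from p to q, so that
   [le0 (orient p q)] is the right half-plane of that line. *)
Definition orient (p q z : pt) : R :=
  (fst q - fst p) * (snd z - snd p) - (snd q - snd p) * (fst z - fst p).

Definition slope (n1 n2 : R) (p z : pt) : R :=
  n1 * (fst z - fst p) + n2 * (snd z - snd p).

(* Boundary points, described by a unit inner normal of a support line. *)
Definition bd (A : region) (p : pt) : Prop :=
  A p /\ exists n1 n2, n1 * n1 + n2 * n2 = 1 /\ forall z, A z -> 0 <= slope n1 n2 p z.

Lemma affine_orient (p q : pt) : affine (orient p q).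
Proof.
exists (- (snd q - snd p)), (fst q - fst p),
  ((fst q - fst p) * snd p - (snd q - snd p) * fst p).
intros z; unfold orient, aff; ring.
Qed.

Lemma affine_slope (n1 n2 : R) (p : pt) : affine (slope n1 n2 p).
Proof.
exists n1, n2, (n1 * fst p + n2 * snd p); intros z; unfold slope, aff; ring.
Qed.

Lemma slope_aff (n1 n2 : R) (p z : pt) :
  slope n1 n2 p z = aff n1 n2 (n1 * fst p + n2 * snd p) z.
Proof. unfold slope, aff; ring. Qed.

Lemma slope_nonconstant (n1 n2 : R) (p : pt) :
  n1 * n1 + n2 * n2 = 1 -> slope n1 n2 p p <> slope n1 n2 p (fst p + n1, snd p + n2).
Proof. intros H; unfold slope; simpl; nra. Qed.

Definition ray (p v : pt) (l : R) : pt := (fst p + l * fst v, snd p + l * snd v).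

Lemma ray_exit (M : nat) (A : region) (p v : pt) :
  Defs.closed_set A -> in_box M A -> A p -> 0 < fst v * fst v + snd v * snd v ->
  exists l, 0 <= l /\ A (ray p v l) /\ forall m, A (ray p v m) -> m <= l.
Proof.
intros HC HM Hp Hv.
set (E := fun l => A (ray p v l)).
assert (HE0 : E 0).
{ unfold E, ray; replace (fst p + 0 * fst v, snd p + 0 * snd v) with p; [exact Hp|].
  destruct p; simpl; f_equal; ring. }
destruct (completeness E) as [l [Hub Hlub]].
- set (s := fst v * fst v + snd v * snd v) in *.
  (* The scalar product of l v with v is l s; each coordinate of l v is a difference of two
     coordinates in [-M, M]. *)
  exists (2 * INR M * (Rabs (fst v) + Rabs (snd v)) / s); intros l Hl.
  destruct (HM _ Hp) as [H1 H2]; destruct (HM _ Hl) as [H3 H4]; simpl in H3, H4.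
  apply Rabs_bounds in H1; apply Rabs_bounds in H2.
  apply Rabs_bounds in H3; apply Rabs_bounds in H4.
  apply Rmult_le_reg_r with s; [lra|].
  replace (2 * INR M * (Rabs (fst v) + Rabs (snd v)) / s * s)
    with (2 * INR M * (Rabs (fst v) + Rabs (snd v))) by (field; lra).
  assert (l * fst v * fst v <= 2 * INR M * Rabs (fst v)).
  { unfold Rabs; destruct (Rcase_abs (fst v)); nra. }
  assert (l * snd v * snd v <= 2 * INR M * Rabs (snd v)).
  { unfold Rabs; destruct (Rcase_abs (snd v)); nra. }
  unfold s; lra.
- now exists 0.
- exists l; split; [now apply Hub|split; [|exact Hub]].
  apply HC; intros eps He.
  set (s := fst v * fst v + snd v * snd v) in *.
  set (d := Rmin 1 (eps / (s + 1))).
  assert (Hd : 0 < d <= 1).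
  { unfold d, Rmin; destruct (Rle_dec 1 (eps / (s + 1))); [lra|].
    split; [apply Rdiv_lt_0_compat; lra|lra]. }
  assert (Hd' : d * (s + 1) <= eps).
  { apply Rle_trans with (eps / (s + 1) * (s + 1)).
    - apply Rmult_le_compat_r; [lra|apply Rmin_r].
    - right; field; lra. }
  assert (Hm : exists m, E m /\ l - d < m).
  { apply NNPP; intros Hn; assert (l <= l - d); [|lra].
    apply Hlub; intros m Hm; apply Rnot_lt_le; intros Hlt; apply Hn; now exists m. }
  destruct Hm as [m [Hm1 Hm2]]; exists (ray p v m); split; [exact Hm1|].
  pose proof (Hub m Hm1).
  replace (dist2 (ray p v l) (ray p v m)) with ((l - m) * (l - m) * s)
    by (unfold dist2, ray, s; simpl; ring).
  assert ((l - m) * (l - m) <= d) by nra.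
  nra.
Qed.

Lemma zero_crossing (f : pt -> R) (u v : pt) :
  affine f -> f u < 0 -> 0 <= f v ->
  exists t, 0 <= t < 1 /\ f (comb t u v) = 0.
Proof.
intros Hf Hu Hv; exists (f v / (f v - f u)).
assert (Ht : f v / (f v - f u) * (f v - f u) = f v) by (field; lra).
set (t := f v / (f v - f u)) in *.
split; [split; nra|rewrite affine_comb by exact Hf; lra].
Qed.

(** In the coordinates [al] along v and [be] across it, the quotients al / be of points with be > 0
    are at most those of points with be < 0. A quotient x separating the two sets gives the support
    line x be - al = 0; if one side holds no point of A, the line along v itself supports A. *)
Lemma exit_bd (A : region) (q v : pt) :
  convex_set A -> A q -> 0 < fst v * fst v + snd v * snd v ->
  (forall m, A (ray q v m) -> m <= 0) -> bd A q.
Proof.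
intros HA Hq Hv Hexit; split; [exact Hq|].
set (s := fst v * fst v + snd v * snd v) in *.
set (al := slope (fst v) (snd v) q).
set (be := slope (- snd v) (fst v) q).
assert (Hal : affine al) by apply affine_slope.
assert (Hbe : affine be) by apply affine_slope.
enough (Hn : exists n1 n2, 0 < n1 * n1 + n2 * n2 /\ forall z, A z -> 0 <= slope n1 n2 q z).
{ destruct Hn as [n1 [n2 [Hn H]]].
  set (r := sqrt (n1 * n1 + n2 * n2)).
  assert (Hr : 0 < r) by now apply sqrt_lt_R0.
  assert (Hr2 : r * r = n1 * n1 + n2 * n2) by (apply sqrt_sqrt; lra).
  exists (n1 / r), (n2 / r); split.
  - replace (n1 / r * (n1 / r) + n2 / r * (n2 / r))
      with ((n1 * n1 + n2 * n2) / (r * r)) by (field; lra).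
    rewrite <- Hr2; field; lra.
  - intros z Hz; specialize (H z Hz).
    replace (slope (n1 / r) (n2 / r) q z) with (slope n1 n2 q z * / r)
      by (unfold slope; field; lra).
    apply Rmult_le_pos; [exact H|left; now apply Rinv_0_lt_compat]. }
assert (Hz0 : forall z, A z -> be z = 0 -> al z <= 0).
{ intros z Hz Hb; assert (al z / s <= 0).
  { apply Hexit; replace (ray q v (al z / s)) with z; [exact Hz|].
    assert (E1 : (fst z - fst q) * s = fst v * al z - snd v * be z)
      by (unfold al, be, slope, s; ring).
    assert (E2 : (snd z - snd q) * s = snd v * al z + fst v * be z)
      by (unfold al, be, slope, s; ring).
    rewrite Hb, Rmult_0_r, Rminus_0_r in E1; rewrite Hb, Rmult_0_r, Rplus_0_r in E2.
    unfold ray; destruct z as [z1 z2]; simpl in *; f_equal.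
    - replace (al (z1, z2) / s * fst v) with ((fst v * al (z1, z2)) / s) by (field; lra).
      rewrite <- E1; field; lra.
    - replace (al (z1, z2) / s * snd v) with ((snd v * al (z1, z2)) / s) by (field; lra).
      rewrite <- E2; field; lra. }
  replace (al z) with (al z / s * s) by (field; lra); nra. }
(* A segment of A across the line through q along v must meet it behind q. *)
assert (Hpair : forall z z', A z -> A z' -> be z < 0 -> 0 < be z' ->
  al z' * be z >= al z * be z').
{ intros z z' Hz Hz' Hb Hb'.
  destruct (zero_crossing be z z' Hbe Hb ltac:(lra)) as [t [Ht E]].
  assert (HA' : A (comb t z z')) by (apply HA; auto; lra).
  pose proof (Hz0 _ HA' E) as H.
  rewrite affine_comb in H, E by assumption.
  assert (t * be z = - (1 - t) * be z') by lra.
  assert ((1 - t) * (al z' * be z - al z * be z') >= 0); [|nra].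
  replace ((1 - t) * (al z' * be z - al z * be z'))
    with ((1 - t) * al z' * be z - al z * ((1 - t) * be z')) by ring.
  replace ((1 - t) * be z') with (- (t * be z)) by lra.
  nra. }
destruct (classic (exists z', A z' /\ 0 < be z')) as [[z' [Hz' Hb']]|Hno].
- destruct (classic (exists z, A z /\ be z < 0)) as [[z [Hz Hb]]|Hno].
  + set (E := fun x => exists w, A w /\ 0 < be w /\ x = al w / be w).
    destruct (completeness E) as [x [Hub Hlub]].
    * exists (al z / be z); intros y [w [Hw [Hbw ->]]].
      pose proof (Hpair z w Hz Hw Hb Hbw).
      apply Rmult_le_reg_r with (be w * - be z); [nra|].
      replace (al w / be w * (be w * - be z)) with (- (al w * be z)) by (field; lra).
      replace (al z / be z * (be w * - be z)) with (- (al z * be w)) by (field; lra).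
      lra.
    * exists (al z' / be z'), z'; auto.
    * exists (x * - snd v - fst v), (x * fst v - snd v); split.
      { replace (_ + _) with (s * (x * x + 1)) by (unfold s; ring). nra. }
      intros w Hw.
      replace (slope _ _ q w) with (x * be w - al w) by (unfold be, al, slope; ring).
      destruct (Rtotal_order (be w) 0) as [Hbw|[Hbw|Hbw]].
      { assert (x <= al w / be w).
        { apply Hlub; intros y [u [Hu [Hbu ->]]].
          pose proof (Hpair w u Hw Hu Hbw Hbu).
          apply Rmult_le_reg_r with (be u * - be w); [nra|].
          replace (al u / be u * (be u * - be w)) with (- (al u * be w)) by (field; lra).
          replace (al w / be w * (be u * - be w)) with (- (al w * be u)) by (field; lra).
          lra. }
        assert (al w / be w * be w = al w) by (field; lra).
        nra. }
      { rewrite Hbw; pose proof (Hz0 w Hw Hbw); lra. }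
      { assert (al w / be w <= x) by (apply Hub; exists w; auto).
        assert (al w / be w * be w = al w) by (field; lra).
        nra. }
  + exists (- snd v), (fst v); split; [unfold s in Hv; nra|].
    intros w Hw; apply Rnot_lt_le; intros H; apply Hno; exists w; auto.
- exists (snd v), (- fst v); split; [unfold s in Hv; nra|].
  intros w Hw; apply Rnot_lt_le; intros H; apply Hno; exists w; split; [exact Hw|].
  unfold be; unfold slope in *; lra.
Qed.

(** * Caps cut off by a rotating line *)

Definition cap (A : region) (f : pt -> R) : R := area (inter (le0 f) A).

Definition rot1 (n1 n2 s : R) : R := cos s * n1 - sin s * n2.
Definition rot2 (n1 n2 s : R) : R := cos s * n2 + sin s * n1.

Section Body.
Context (M : nat) (A : region).
Hypothesis Aclosed : Defs.closed_set A.
Hypothesis Atame : tame M A.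
Hypothesis Ainterior : nonempty_interior A.

Lemma body_area_pos : 0 < area A.
Proof. exact (area_interior M A Atame Ainterior). Qed.

Lemma rot_unit (n1 n2 s : R) :
  n1 * n1 + n2 * n2 = 1 ->
  rot1 n1 n2 s * rot1 n1 n2 s + rot2 n1 n2 s * rot2 n1 n2 s = 1.
Proof.
intros H; unfold rot1, rot2.
pose proof (sin2_cos2 s) as Hs; unfold Rsqr in Hs.
replace (_ + _) with ((sin s * sin s + cos s * cos s) * (n1 * n1 + n2 * n2)) by ring.
rewrite Hs, H; ring.
Qed.

Lemma cap_slope (n1 n2 : R) (o : pt) :
  cap A (slope n1 n2 o) = area (inter (le0 (aff n1 n2 (n1 * fst o + n2 * snd o))) A).
Proof.
unfold cap; f_equal; apply region_ext; intros z; unfold inter, le0.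
rewrite slope_aff; tauto.
Qed.

Lemma cap_slope_lip (o : pt) (a b a' b' : R) :
  a * a + b * b = 1 ->
  cap A (slope a' b' o) <= cap A (slope a b o) +
    lip M * (Rabs (fst o) + Rabs (snd o) + INR M) * (Rabs (a - a') + Rabs (b - b')).
Proof.
intros Hab; rewrite !cap_slope.
apply Rle_trans with (1 := area_lip M A a b (a * fst o + b * snd o) a' b' _ Atame Hab).
apply Rplus_le_compat_l; rewrite Rmult_assoc; apply Rmult_le_compat_l.
- unfold lip; pose proof (pos_INR M); lra.
- replace (a * fst o + b * snd o - (a' * fst o + b' * snd o))
    with ((a - a') * fst o + (b - b') * snd o) by ring.
  pose proof (Rabs_triang ((a - a') * fst o) ((b - b') * snd o)) as H.
  rewrite !Rabs_mult in H.
  pose proof (Rabs_pos (a - a')); pose proof (Rabs_pos (b - b')).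
  pose proof (Rabs_pos (fst o)); pose proof (Rabs_pos (snd o)).
  nra.
Qed.

Lemma cap_rot_continuity (o : pt) (n1 n2 : R) :
  n1 * n1 + n2 * n2 = 1 ->
  continuity (fun s => cap A (slope (rot1 n1 n2 s) (rot2 n1 n2 s) o)).
Proof.
intros Hn s eps He.
set (C := lip M * (Rabs (fst o) + Rabs (snd o) + INR M)).
assert (HC : 0 <= C).
{ unfold C, lip; pose proof (pos_INR M).
  pose proof (Rabs_pos (fst o)); pose proof (Rabs_pos (snd o)).
  apply Rmult_le_pos; lra. }
assert (He' : 0 < eps / (2 * (C + 1))) by (apply Rdiv_lt_0_compat; lra).
assert (H1 : continuity (rot1 n1 n2)) by (unfold rot1; reg).
assert (H2 : continuity (rot2 n1 n2)) by (unfold rot2; reg).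
destruct (H1 s _ He') as [d1 [Hd1 K1]]; destruct (H2 s _ He') as [d2 [Hd2 K2]].
exists (Rmin d1 d2); split; [now apply Rmin_glb_lt|].
intros s' [HD Hs']; simpl in *; unfold Rdist in *.
assert (L1 : Rabs (rot1 n1 n2 s' - rot1 n1 n2 s) < eps / (2 * (C + 1))).
{ apply K1; split; [exact HD|]. apply Rlt_le_trans with (1 := Hs'), Rmin_l. }
assert (L2 : Rabs (rot2 n1 n2 s' - rot2 n1 n2 s) < eps / (2 * (C + 1))).
{ apply K2; split; [exact HD|]. apply Rlt_le_trans with (1 := Hs'), Rmin_r. }
pose proof (cap_slope_lip o _ _ (rot1 n1 n2 s') (rot2 n1 n2 s') (rot_unit n1 n2 s Hn)) as B1.
pose proof (cap_slope_lip o _ _ (rot1 n1 n2 s) (rot2 n1 n2 s) (rot_unit n1 n2 s' Hn)) as B2.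
fold C in B1, B2.
rewrite (Rabs_minus_sym (rot1 n1 n2 s)), (Rabs_minus_sym (rot2 n1 n2 s)) in B1.
set (D := Rabs (rot1 n1 n2 s' - rot1 n1 n2 s) + Rabs (rot2 n1 n2 s' - rot2 n1 n2 s)) in *.
assert (HD' : D <= eps / (C + 1)).
{ replace (eps / (C + 1)) with (eps / (2 * (C + 1)) + eps / (2 * (C + 1))) by (field; lra).
  unfold D; lra. }
assert (HD0 : 0 <= D).
{ unfold D; apply Rplus_le_le_0_compat; apply Rabs_pos. }
assert (C * D < eps).
{ assert (E : eps / (C + 1) * (C + 1) = eps) by (field; lra).
  assert (0 < eps / (C + 1)) by (apply Rdiv_lt_0_compat; lra).
  nra. }
apply Rabs_def1; lra.
Qed.

(** Half a turn carries the normal to its opposite; the hypothesis asks for a change of sign between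
    these two positions. *)
Lemma cap_rot_ivt (o : pt) (n1 n2 g : R) :
  n1 * n1 + n2 * n2 = 1 ->
  (cap A (slope n1 n2 o) - g) * (cap A (slope (- n1) (- n2) o) - g) <= 0 ->
  exists s, 0 <= s <= PI /\ cap A (slope (rot1 n1 n2 s) (rot2 n1 n2 s) o) = g.
Proof.
intros Hn Hg.
destruct (IVT_cor (fun s => cap A (slope (rot1 n1 n2 s) (rot2 n1 n2 s) o) - g) 0 PI)
  as [s [Hs E]].
- apply continuity_minus; [now apply cap_rot_continuity|apply continuity_const].
  intros x y; reflexivity.
- left; exact PI_RGT_0.
- replace (rot1 n1 n2 0) with n1 by (unfold rot1; rewrite cos_0, sin_0; ring).
  replace (rot2 n1 n2 0) with n2 by (unfold rot2; rewrite cos_0, sin_0; ring).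
  replace (rot1 n1 n2 PI) with (- n1) by (unfold rot1; rewrite cos_PI, sin_PI; ring).
  replace (rot2 n1 n2 PI) with (- n2) by (unfold rot2; rewrite cos_PI, sin_PI; ring).
  exact Hg.
- exists s; split; [exact Hs|lra].
Qed.

Lemma cap_opp (f : pt -> R) (p q : pt) :
  affine f -> f p <> f q -> cap A (fun z => - f z) = area A - cap A f.
Proof. intros Hf Hn; exact (area_opp M A f p q Atame Hf Hn). Qed.

Lemma area_gt0 (f : pt -> R) : affine f -> area (inter (gt0 f) A) = area A - cap A f.
Proof. intros Hf; pose proof (area_split M A f Hf Atame); unfold cap; lra. Qed.

Lemma area_empty (K : region) : tame M K -> (forall p, ~ K p) -> area K = 0.
Proof.
intros HK Hn; pose proof (area_nonneg M K HK).
pose proof (area_pack M K K K HK HK HK (fun _ H => H) (fun _ H => H) (fun p H _ => Hn p H)).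
lra.
Qed.

Lemma cap_pos_point (f : pt -> R) (p q : pt) :
  affine f -> f p <> f q -> 0 < cap A f -> exists w, A w /\ f w < 0.
Proof.
intros Hf Hn Hc; apply NNPP; intros H.
unfold cap in Hc; rewrite <- (area_lt0 M A f p q Atame Hf Hn) in Hc.
rewrite area_empty in Hc; [lra|auto using tame_lt0|].
intros w [H1 H2]; apply H; exists w; auto.
Qed.

Lemma gt0_pos_point (f : pt -> R) :
  affine f -> cap A f < area A -> exists w, A w /\ 0 < f w.
Proof.
intros Hf Hc; apply NNPP; intros H.
pose proof (area_gt0 f Hf) as E; rewrite area_empty in E; [lra|auto using tame_gt0|].
intros w [H1 H2]; apply H; exists w; auto.
Qed.

(** The caps at the two ends of half a turn add up to A, so they deviate from half the area by
    opposite amounts. The initial normal is arbitrary. *)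
Lemma halving_line (o : pt) :
  exists a b, a * a + b * b = 1 /\ cap A (slope a b o) = area A / 2.
Proof.
destruct (cap_rot_ivt o 1 0 (area A / 2)) as [s [_ Hs]]; [ring| |].
- assert (E : cap A (slope (- (1)) (- 0) o) = area A - cap A (slope 1 0 o)).
  { rewrite <- (cap_opp (slope 1 0 o) o (fst o + 1, snd o + 0));
      [|apply affine_slope|apply slope_nonconstant; ring].
    unfold cap; f_equal; apply region_ext; intros z; unfold inter, le0, slope.
    split; intros [H1 H2]; split; try exact H2; lra. }
  rewrite E; pose proof (Rle_0_sqr (cap A (slope 1 0 o) - area A / 2)) as Hsq.
  unfold Rsqr in Hsq; lra.
- exists (rot1 1 0 s), (rot2 1 0 s); split; [apply rot_unit; ring|exact Hs].
Qed.

Lemma exists_bd : exists p, bd A p.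
Proof.
destruct Ainterior as [o [r [Hr Ho]]].
assert (HAo : A o).
{ apply Ho; unfold dist2; replace ((fst o - fst o) ^ 2 + (snd o - snd o) ^ 2) with 0 by ring;
  exact Hr. }
destruct (ray_exit M A o (1, 0) Aclosed (proj1 Atame) HAo) as [l [Hl [H1 H2]]];
  [simpl; lra|].
exists (ray o (1, 0) l); apply exit_bd with (1, 0); [apply Atame|exact H1|simpl; lra|].
intros m Hm; assert (l + m <= l); [|lra].
apply H2; revert Hm; unfold ray; simpl.
now replace (fst o + l * 1 + m * 1) with (fst o + (l + m) * 1) by ring;
replace (snd o + l * 0 + m * 0) with (snd o + (l + m) * 0) by ring.
Qed.

Lemma bd_slope (p : pt) :
  bd A p -> exists n1 n2, n1 * n1 + n2 * n2 = 1 /\ (forall z, A z -> 0 <= slope n1 n2 p z)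
    /\ cap A (slope n1 n2 p) = 0 /\ cap A (slope (- n1) (- n2) p) = area A.
Proof.
intros [Hp [n1 [n2 [Hn H]]]]; exists n1, n2; split; [exact Hn|split; [exact H|]].
assert (E : cap A (slope n1 n2 p) = 0).
{ unfold cap; rewrite <- (area_lt0 M A _ p (fst p + n1, snd p + n2) Atame);
    [|apply affine_slope|now apply slope_nonconstant].
  apply area_empty; [apply tame_lt0; [apply affine_slope|exact Atame]|].
  intros z [H1 H2]; specialize (H z H2); unfold lt0 in H1; lra. }
split; [exact E|].
transitivity (cap A (fun z => - slope n1 n2 p z)).
- unfold cap; f_equal; apply region_ext; intros z; unfold inter, le0, slope.
  split; intros [H1 H2]; split; try exact H2; lra.
- rewrite (cap_opp _ p (fst p + n1, snd p + n2));
    [rewrite E; ring|apply affine_slope|now apply slope_nonconstant].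
Qed.

(* Rotating a line around p away from the support line sweeps caps of every area. *)
Lemma next_chord (p : pt) (g : R) :
  bd A p -> 0 < g < area A -> exists q, bd A q /\ cap A (orient p q) = g.
Proof.
intros Hp Hg.
destruct (bd_slope p Hp) as [n1 [n2 [Hn [Hsup [E0 E1]]]]].
destruct (cap_rot_ivt p n1 n2 g Hn) as [s [Hs E]]; [rewrite E0, E1; nra|].
(* At the angles 0 and PI the caps have area 0 and |A|, both different from g. *)
assert (Hsin : 0 < sin s).
{ apply sin_gt_0.
  - destruct (Rle_lt_or_eq_dec _ _ (proj1 Hs)) as [Hlt | <-]; [exact Hlt|exfalso].
    revert E; unfold rot1, rot2; rewrite cos_0, sin_0.
    replace (1 * n1 - 0 * n2) with n1 by ring; replace (1 * n2 + 0 * n1) with n2 by ring.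
    lra.
  - destruct (Rle_lt_or_eq_dec _ _ (proj2 Hs)) as [Hlt | ->]; [exact Hlt|exfalso].
    revert E; unfold rot1, rot2; rewrite cos_PI, sin_PI.
    replace (-1 * n1 - 0 * n2) with (- n1) by ring.
    replace (-1 * n2 + 0 * n1) with (- n2) by ring.
    lra. }
pose proof (rot_unit n1 n2 s Hn) as Hab.
assert (Hdot : n1 * rot2 n1 n2 s - n2 * rot1 n1 n2 s = sin s).
{ unfold rot1, rot2; replace (sin s) with (sin s * (n1 * n1 + n2 * n2)) at 3
    by (rewrite Hn; ring). ring. }
set (a := rot1 n1 n2 s) in *; set (b := rot2 n1 n2 s) in *.
set (f := slope a b p) in *; set (h := slope n1 n2 p) in *.
assert (Hf : affine f) by apply affine_slope.
assert (Hh : affine h) by apply affine_slope.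
(* A point of A on the rotated line, strictly inside the support line, shows that the ray from p
   along v enters A. Hence its last point q differs from p, and [orient p q] is a positive multiple
   of f. *)
assert (Hw : exists w, A w /\ f w = 0 /\ 0 < h w).
{ destruct (cap_pos_point f p (fst p + a, snd p + b)) as [w1 [Hw1 Fw1]];
    [exact Hf|now apply slope_nonconstant|lra|].
  destruct (gt0_pos_point f) as [w2 [Hw2 Fw2]]; [exact Hf|lra|].
  destruct (gt0_pos_point h) as [c [Hc Fc]]; [exact Hh|lra|].
  pose proof (Hsup w1 Hw1) as S1; pose proof (Hsup w2 Hw2) as S2.
  destruct (Rtotal_order (f c) 0) as [Hfc|[Hfc|Hfc]].
  - destruct (zero_crossing (fun z => - f z) w2 c) as [t [Ht E']];
      [now apply affine_opp|lra|lra|].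
    exists (comb t w2 c); repeat split; [apply (proj2 Atame); auto; lra|lra|].
    rewrite affine_comb by exact Hh; nra.
  - exists c; auto.
  - destruct (zero_crossing f w1 c) as [t [Ht E']]; [exact Hf|lra|lra|].
    exists (comb t w1 c); repeat split; [apply (proj2 Atame); auto; lra|lra|].
    rewrite affine_comb by exact Hh; nra. }
destruct Hw as [w [Hw [Fw Gw]]].
set (v := (b, - a)).
set (l0 := b * (fst w - fst p) - a * (snd w - snd p)).
assert (Ew1 : fst w - fst p = l0 * b).
{ unfold l0; unfold f, slope in Fw.
  transitivity ((fst w - fst p) * (a * a + b * b) - a * (a * (fst w - fst p) + b * (snd w - snd p)));
  [rewrite Fw, Hab|]; ring. }
assert (Ew2 : snd w - snd p = - l0 * a).
{ unfold l0; unfold f, slope in Fw.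
  transitivity ((snd w - snd p) * (a * a + b * b) - b * (a * (fst w - fst p) + b * (snd w - snd p)));
  [rewrite Fw, Hab|]; ring. }
assert (Hl0 : 0 < l0).
{ unfold h, slope in Gw; rewrite Ew1, Ew2 in Gw.
  replace (n1 * (l0 * b) + n2 * (- l0 * a)) with (l0 * sin s) in Gw
    by (rewrite <- Hdot; ring).
  nra. }
destruct (ray_exit M A p v Aclosed (proj1 Atame) (proj1 Hp)) as [l [_ [H1 H2]]];
  [simpl; lra|].
assert (Hl : l0 <= l).
{ apply H2; replace (ray p v l0) with w; [exact Hw|].
  unfold ray, v; destruct w; simpl in *; f_equal; lra. }
exists (ray p v l); split.
- apply exit_bd with v; [apply Atame|exact H1|simpl; lra|].
  intros m Hm; assert (l + m <= l); [|lra].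
  apply H2; revert Hm; unfold ray; simpl.
  now replace (fst p + l * b + m * b) with (fst p + (l + m) * b) by ring;
  replace (snd p + l * - a + m * - a) with (snd p + (l + m) * - a) by ring.
- rewrite <- E; unfold cap; f_equal; apply region_ext; intros z; unfold inter, le0.
  replace (orient p (ray p v l) z) with (l * f z)
    by (unfold orient, ray, v, f, slope; simpl; ring).
  split; intros [K1 K2]; split; try exact K2; nra.
Qed.

End Body.

(** * Chords cutting off a fixed area *)

(** Points on the line count as its right side, so each vertex lies on exactly one side and a vertex
    on the line is not counted twice. *)
Definition down (f : pt -> R) (p q : pt) : Prop := 0 < f p /\ f q <= 0.

(** [c] is a potential: its increments pay for the difference of the two counts and add up to at
    most 1. It will record in which sector the current vertex lies. *)
Lemma nsum_telescope (n : nat) (u v c : nat -> R) :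
  (forall i, 0 <= c i <= 1) -> (forall i, u i <= v i + c (S i) - c i) ->
  nsum n u <= nsum n v + 1.
Proof.
intros Hc H.
assert (nsum n u <= nsum n v + c n - c 0%nat).
{ induction n as [|n IH]; simpl; [lra|]. specialize (H n); lra. }
pose proof (Hc n); pose proof (Hc 0%nat); lra.
Qed.

(** A support line at a point strictly inside a segment of A contains that segment, so it is the
    line f = 0; but A has points strictly on both sides of it. *)
Lemma bd_between (A : region) (x u v : pt) (t : R) (f : pt -> R) (w1 w2 : pt) :
  bd A x -> A u -> A v -> u <> v -> 0 < t < 1 -> x = comb t u v ->
  affine f -> f u = 0 -> f v = 0 -> A w1 -> A w2 -> f w1 < 0 -> 0 < f w2 -> False.
Proof.
intros [_ [n1 [n2 [Hn Hs]]]] Hu Hv Huv Ht Ex Hf Fu Fv Hw1 Hw2 F1 F2.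
pose proof (Hs u Hu) as Su; pose proof (Hs v Hv) as Sv.
assert (E : t * slope n1 n2 x u + (1 - t) * slope n1 n2 x v = 0).
{ rewrite <- affine_comb, <- Ex by apply affine_slope; unfold slope; ring. }
assert (Su0 : slope n1 n2 x u = 0) by nra.
assert (Fx : f x = 0) by (rewrite Ex, affine_comb, Fu, Fv by exact Hf; ring).
destruct Hf as [a [b [c Hf]]].
set (e1 := fst u - fst x) in *; set (e2 := snd u - snd x) in *.
assert (He : e1 <> 0 \/ e2 <> 0).
{ apply NNPP; intros H; apply Huv.
  assert (E1 : e1 = 0) by (apply NNPP; tauto).
  assert (E2 : e2 = 0) by (apply NNPP; tauto).
  unfold e1 in E1; unfold e2 in E2; rewrite Ex in E1, E2; unfold comb in E1, E2; simpl in *.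
  destruct u as [u1 u2]; destruct v as [v1 v2]; simpl in *.
  assert (u1 - v1 = 0) by (apply Rmult_eq_reg_l with (1 - t); lra).
  assert (u2 - v2 = 0) by (apply Rmult_eq_reg_l with (1 - t); lra).
  f_equal; lra. }
assert (Ef : a * e1 + b * e2 = 0).
{ rewrite Hf in Fu, Fx; unfold aff, e1, e2 in *; lra. }
unfold slope in Su0; fold e1 e2 in Su0.
assert (Ed : a * n2 - b * n1 = 0).
{ destruct He as [He|He].
  - apply Rmult_eq_reg_l with e1; [|exact He].
    transitivity (n2 * (a * e1 + b * e2) - b * (n1 * e1 + n2 * e2)); [ring|].
    rewrite Ef, Su0; ring.
  - apply Rmult_eq_reg_l with e2; [|exact He].
    transitivity (a * (n1 * e1 + n2 * e2) - n1 * (a * e1 + b * e2)); [ring|].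
    rewrite Ef, Su0; ring. }
set (k := a * n1 + b * n2).
assert (Ea : a = k * n1).
{ transitivity (a * (n1 * n1 + n2 * n2)); [rewrite Hn; ring|].
  unfold k; transitivity ((a * n1 + b * n2) * n1 + n2 * (a * n2 - b * n1)); [ring|].
  rewrite Ed; ring. }
assert (Eb : b = k * n2).
{ transitivity (b * (n1 * n1 + n2 * n2)); [rewrite Hn; ring|].
  unfold k; transitivity ((a * n1 + b * n2) * n2 - n1 * (a * n2 - b * n1)); [ring|].
  rewrite Ed; ring. }
assert (Ek : forall z, f z = k * slope n1 n2 x z).
{ intros z; rewrite Hf in *; unfold aff, slope in *.
  transitivity (a * (fst z - fst x) + b * (snd z - snd x)); [lra|].
  rewrite Ea at 1; rewrite Eb at 1; ring. }
pose proof (Hs w1 Hw1); pose proof (Hs w2 Hw2).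
rewrite Ek in F1, F2.
destruct (Rle_or_lt k 0); nra.
Qed.

Lemma comb_0 (p q : pt) : comb 0 p q = q.
Proof. destruct q; unfold comb; simpl; f_equal; ring. Qed.

Lemma comb_1 (p q : pt) : comb 1 p q = p.
Proof. destruct p; unfold comb; simpl; f_equal; ring. Qed.

Lemma near_point (f : pt -> R) (u v : pt) :
  affine f -> 0 < f v -> exists t, 0 < t < 1 /\ 0 < f (comb t u v).
Proof.
intros Hf Hv.
exists (f v / (2 * (f v + Rabs (f u)))).
pose proof (Rabs_pos (f u)) as Hu.
set (t := f v / (2 * (f v + Rabs (f u)))).
assert (Ht : t * (2 * (f v + Rabs (f u))) = f v) by (unfold t; field; lra).
assert (0 < t) by (unfold t; apply Rdiv_lt_0_compat; lra).
assert (t < 1) by nra.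
split; [lra|rewrite affine_comb by exact Hf].
assert (- Rabs (f u) <= f u) by (pose proof (Rle_abs (- f u)); rewrite Rabs_Ropp in *; lra).
assert (t * - Rabs (f u) <= t * f u) by (apply Rmult_le_compat_l; lra).
lra.
Qed.

Section Chords.
Context (M : nat) (A : region) (alpha : R).
Hypothesis Atame : tame M A.
Hypothesis Ainterior : nonempty_interior A.
Hypothesis Halpha : 0 < alpha < 1 / 2.

Let Apos : 0 < area A := body_area_pos M A Atame Ainterior.
Let Aconv : convex_set A := proj2 Atame.

Lemma A_comb (t : R) (u v : pt) : A u -> A v -> 0 <= t <= 1 -> A (comb t u v).
Proof. intros Hu Hv Ht; now apply Aconv. Qed.

Definition chord (p q : pt) : Prop :=
  bd A p /\ bd A q /\ cap A (orient p q) = alpha * area A.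

(** If p = q the cap would be all of A. The second point is p moved by the vector from p to q turned
    by a right angle. *)
Lemma chord_nonconstant (p q : pt) :
  chord p q -> orient p q p <> orient p q (fst p - (snd q - snd p), snd p + (fst q - fst p)).
Proof.
intros [_ [_ Hc]] E.
assert (E0 : (fst q - fst p) * (fst q - fst p) + (snd q - snd p) * (snd q - snd p) = 0)
  by (unfold orient in E; simpl in E; lra).
destruct (Rplus_sqr_eq_0 _ _ E0) as [E1 E2].
assert (H : inter (le0 (orient p q)) A = A).
{ apply region_ext; intros z; unfold inter, le0, orient; rewrite E1, E2.
  split; [tauto|intros Hz; split; [lra|exact Hz]]. }
unfold cap in Hc; rewrite H in Hc; nra.
Qed.

Lemma chord_neg (p q : pt) : chord p q -> exists w, A w /\ orient p q w < 0.
Proof.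
intros H; eapply cap_pos_point;
  [exact Atame|apply affine_orient|now apply chord_nonconstant|].
destruct H as [_ [_ ->]]; nra.
Qed.

Lemma chord_pos (p q : pt) : chord p q -> exists w, A w /\ 0 < orient p q w.
Proof.
intros [_ [_ H]]; apply (gt0_pos_point M A Atame); [apply affine_orient|rewrite H; nra].
Qed.

Lemma orient_start (p q : pt) : orient p q p = 0.
Proof. unfold orient; ring. Qed.

Lemma orient_end (p q : pt) : orient p q q = 0.
Proof. unfold orient; ring. Qed.

Lemma chord_neq (p q : pt) : chord p q -> p <> q.
Proof.
intros H ->; destruct (chord_neg _ _ H) as [w [_ Hw]]; unfold orient in Hw; lra.
Qed.

(** A point of A on the line beyond p or q would put that boundary point strictly between two points
    of A, on a line with A on both sides. *)
Lemma chord_between (p q w : pt) :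
  chord p q -> A w -> orient p q w = 0 -> exists r, 0 <= r <= 1 /\ w = comb r p q.
Proof.
intros H Hw Ew.
destruct (chord_neg _ _ H) as [w1 [Hw1 F1]]; destruct (chord_pos _ _ H) as [w2 [Hw2 F2]].
pose proof (chord_neq _ _ H) as Hpq.
destruct H as [Hp [Hq _]].
set (d1 := fst q - fst p); set (d2 := snd q - snd p).
assert (Hd : 0 < d1 * d1 + d2 * d2).
{ assert (d1 <> 0 \/ d2 <> 0); [|nra].
  apply NNPP; intros H; apply Hpq; destruct p, q; simpl in *; unfold d1, d2 in H.
  f_equal; apply NNPP; intuition lra. }
set (t := ((fst w - fst p) * d1 + (snd w - snd p) * d2) / (d1 * d1 + d2 * d2)).
assert (Ht : t * (d1 * d1 + d2 * d2) = (fst w - fst p) * d1 + (snd w - snd p) * d2)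
  by (unfold t; field; lra).
unfold orient in Ew; fold d1 d2 in Ew.
assert (E1 : fst w - fst p = t * d1).
{ apply Rmult_eq_reg_l with (d1 * d1 + d2 * d2); [|lra].
  transitivity (d1 * (t * (d1 * d1 + d2 * d2)));
  [rewrite Ht|ring].
  transitivity (d1 * ((fst w - fst p) * d1 + (snd w - snd p) * d2)
    - d2 * (d1 * (snd w - snd p) - d2 * (fst w - fst p))); [ring|rewrite Ew; ring]. }
assert (E2 : snd w - snd p = t * d2).
{ apply Rmult_eq_reg_l with (d1 * d1 + d2 * d2); [|lra].
  transitivity (d2 * (t * (d1 * d1 + d2 * d2)));
  [rewrite Ht|ring].
  transitivity (d2 * ((fst w - fst p) * d1 + (snd w - snd p) * d2)
    + d1 * (d1 * (snd w - snd p) - d2 * (fst w - fst p))); [ring|rewrite Ew; ring]. }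
assert (Ow : orient p q w = 0) by (unfold orient; fold d1 d2; rewrite E1, E2; ring).
destruct (Rlt_or_le t 0) as [Ht0|Ht0]; [exfalso|destruct (Rlt_or_le 1 t) as [Ht1|Ht1]; [exfalso|]].
- assert (Es : / (1 - t) * (1 - t) = 1) by (field; lra).
  assert (0 < / (1 - t)) by (apply Rinv_0_lt_compat; lra).
  apply (bd_between A p w q (/ (1 - t)) (orient p q) w1 w2);
    auto using affine_orient, orient_end; try apply Hq; [|nra|].
  + intros ->; fold d1 in E1; fold d2 in E2.
    assert ((1 - t) * (d1 * d1 + d2 * d2) = 0); [|nra].
    rewrite Rmult_minus_distr_r, Ht; unfold d1, d2; ring.
  + unfold comb; destruct p as [p1 p2]; simpl in *.
    f_equal; apply Rmult_eq_reg_l with (1 - t); try lra; field_simplify; unfold d1, d2 in *; lra.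
- assert (Es : / t * t = 1) by (field; lra).
  assert (0 < / t) by (apply Rinv_0_lt_compat; lra).
  apply (bd_between A q w p (/ t) (orient p q) w1 w2);
    auto using affine_orient, orient_start; try apply Hp; [|nra|].
  + intros ->. assert (t * (d1 * d1 + d2 * d2) = 0); [|nra]. rewrite Ht; ring.
  + unfold comb; destruct q as [q1 q2]; simpl in *.
    f_equal; apply Rmult_eq_reg_l with t; try lra; field_simplify; unfold d1, d2 in *; lra.
- exists (1 - t); split; [lra|].
  unfold comb; destruct w as [x y]; simpl in *; unfold d1, d2 in *; f_equal; lra.
Qed.

(** Near w a piece of A of positive area lies in the second cap and outside the first. *)
Lemma cap_strict (f g : pt -> R) (w : pt) :
  affine f -> affine g -> (forall z, A z -> f z <= 0 -> g z <= 0) ->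
  A w -> 0 < f w -> g w < 0 -> cap A f < cap A g.
Proof.
intros Hf Hg H Hw Fw Gw.
assert (Hg' : affine (fun z => - g z)) by now apply affine_opp.
pose proof (area_near M A f (fun z => - g z) w Atame Ainterior Hf Hg' Hw Fw ltac:(lra)) as Hp.
enough (cap A f + area (inter (gt0 f) (inter (gt0 (fun z => - g z)) A)) <= cap A g) by lra.
apply (area_pack M); auto using tame_le0, tame_gt0; unfold inter, le0, gt0.
- intros z [H1 H2]; split; auto.
- intros z [H1 [H2 H3]]; split; [lra|exact H3].
- intros z; lra.
Qed.

(** The part of A where f <= 0 is convex and does not meet the chord, on which f > 0; so it stays on
    the side of o. *)
Lemma chord_skip (p q o : pt) (f : pt -> R) :
  chord p q -> affine f -> 0 < f p -> 0 < f q -> A o -> f o <= 0 -> orient p q o < 0 ->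
  forall w, A w -> f w <= 0 -> orient p q w < 0.
Proof.
intros Hc Hf Fp Fq Ho Fo Oo w Hw Fw; apply Rnot_le_lt; intros Ow.
destruct (zero_crossing (orient p q) o w (affine_orient p q) Oo Ow) as [t [Ht E]].
destruct (chord_between p q _ Hc (A_comb t o w Ho Hw ltac:(lra)) E) as [r [Hr Er]].
assert (f (comb t o w) <= 0) by (rewrite affine_comb by exact Hf; nra).
rewrite Er, affine_comb in H by exact Hf; nra.
Qed.

(** The counterpart of [chord_skip] with sides exchanged: now the part of A where f > 0 avoids the
    chord. *)
Lemma chord_inside (p q u v : pt) (f : pt -> R) :
  chord p q -> affine f -> f p <= 0 -> f q <= 0 -> A u -> A v -> 0 < f u -> 0 < f v ->
  orient p q u < 0 -> orient p q v < 0.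
Proof.
intros Hc Hf Fp Fq Hu Hv Fu Fv Ou; apply Rnot_le_lt; intros Ov.
destruct (zero_crossing (orient p q) u v (affine_orient p q) Ou Ov) as [t [Ht E]].
destruct (chord_between p q _ Hc (A_comb t u v Hu Hv ltac:(lra)) E) as [r [Hr Er]].
assert (0 < f (comb t u v)) by (rewrite affine_comb by exact Hf; nra).
rewrite Er, affine_comb in H by exact Hf; nra.
Qed.

Lemma chord_midpoint_not_bd (p q : pt) : chord p q -> ~ bd A (comb (1 / 2) p q).
Proof.
intros H Hb.
destruct (chord_neg _ _ H) as [w1 [Hw1 F1]]; destruct (chord_pos _ _ H) as [w2 [Hw2 F2]].
pose proof (chord_neq _ _ H) as Hpq; destruct H as [Hp [Hq _]].
apply (bd_between A _ p q (1 / 2) (orient p q) w1 w2 Hb);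
  auto using affine_orient, orient_start, orient_end; try apply Hp; try apply Hq; lra.
Qed.

(* If the path did not turn left at q, the two caps would cover A, but 2 alpha < 1. *)
Lemma consecutive_caps (p q r y : pt) :
  chord p q -> chord q r -> A y -> orient p q y < 0 -> orient q r y < 0 -> False.
Proof.
intros H1 H2 Hy O1 O2.
destruct (chord_neg _ _ H1) as [w1 [Hw1 F1]]; destruct (chord_pos _ _ H1) as [w2 [Hw2 F2]].
assert (Hp : A p) by apply H1. assert (Hr : A r) by apply H2.
destruct (proj1 H2) as [_ [n1 [n2 [Hn Hs]]]].
set (h := slope n1 n2 q) in *.
set (X := fun u v : pt =>
  (fst u - fst q) * (snd v - snd q) - (snd u - snd q) * (fst v - fst q)).
(* As A lies in h >= 0, the cross products [X] order directions at q like angles in a half-plane;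
   this identity replaces transitivity. *)
assert (Hid : forall u v w, h u * X v w + h v * X w u + h w * X u v = 0)
  by (intros; unfold h, slope, X; ring).
assert (Hsym : forall u v, X u v = - X v u) by (intros; unfold X; ring).
assert (Opq : forall z, orient p q z = - X p z) by (intros; unfold orient, X; ring).
assert (Oqr : forall z, orient q r z = X r z) by (intros; unfold orient, X; ring).
(* otherwise the line p q would support A *)
assert (Hhp : 0 < h p).
{ apply Rnot_le_lt; intros Hle; assert (h0 : h p = 0) by (pose proof (Hs p Hp); lra).
  assert (P1 : fst p - fst q = n2 * X p (fst q + n1, snd q + n2)).
  { transitivity ((fst p - fst q) * (n1 * n1 + n2 * n2) - n1 * h p); [rewrite Hn, h0; ring|].
    unfold h, slope, X; simpl; ring. }
  assert (P2 : snd p - snd q = - n1 * X p (fst q + n1, snd q + n2)).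
  { transitivity ((snd p - snd q) * (n1 * n1 + n2 * n2) - n2 * h p); [rewrite Hn, h0; ring|].
    unfold h, slope, X; simpl; ring. }
  assert (Hz : forall z, orient p q z = - X p (fst q + n1, snd q + n2) * h z).
  { intros z; rewrite Opq; unfold X at 1; rewrite P1, P2; unfold h, slope; ring. }
  pose proof (Hs w1 Hw1); pose proof (Hs w2 Hw2).
  rewrite Hz in F1, F2.
  destruct (Rle_or_lt (X p (fst q + n1, snd q + n2)) 0); nra. }
rewrite Opq in O1; rewrite Oqr in O2.
(* [X r p] is [orient p q r]. If it is not positive there is no left turn at q and the caps cover A;
   otherwise the identity at y, r, p has nonnegative terms, one of them positive. *)
destruct (Rle_or_lt (X r p) 0) as [Hrp|Hrp].
- assert (Hcov : area A <= cap A (orient p q) + cap A (orient q r)).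
  { apply (area_cover M); auto using tame_le0, affine_orient.
    intros z Hz; unfold inter, le0.
    destruct (Rle_or_lt (orient p q z) 0) as [|Z1]; [tauto|].
    destruct (Rle_or_lt (orient q r z) 0) as [|Z2]; [tauto|exfalso].
    rewrite Opq in Z1; rewrite Oqr in Z2.
    pose proof (Hid z p r) as E; rewrite (Hsym p r), (Hsym z p) in E.
    pose proof (Hs z Hz); pose proof (Hs r Hr). nra. }
  destruct H1 as [_ [_ ->]] in Hcov; destruct H2 as [_ [_ ->]] in Hcov; nra.
- pose proof (Hid y r p) as E; rewrite (Hsym y r) in E.
  pose proof (Hs y Hy); pose proof (Hs r Hr). nra.
Qed.

End Chords.

(** * Halving lines and crossing counts *)

Ltac chi_solve :=
  repeat match goal with
  | |- context [chi ?P] =>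
    first [rewrite (ind_true P) by (repeat split; assumption || lra)
          |rewrite (ind_false P) by (intros HH; repeat destruct HH as [? HH]; lra)]
  end; lra.

Section Halving.
Context (M : nat) (A : region).
Hypothesis Atame : tame M A.
Hypothesis Ainterior : nonempty_interior A.

Let Apos : 0 < area A := body_area_pos M A Atame Ainterior.
Let Aconv : convex_set A := proj2 Atame.

(** Both open sides are prescribed, which makes the notion symmetric under f -> - f. *)
Definition halving (f : pt -> R) : Prop :=
  affine f /\ area (inter (lt0 f) A) = area A / 2 /\ area (inter (gt0 f) A) = area A / 2.

Lemma halving_slope (a b : R) (o : pt) :
  a * a + b * b = 1 -> cap A (slope a b o) = area A / 2 -> halving (slope a b o).
Proof.
intros Hab Hc; split; [apply affine_slope|split].
- rewrite (area_lt0 M A _ o (fst o + a, snd o + b) Atame);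
    [exact Hc|apply affine_slope|now apply slope_nonconstant].
- rewrite (area_gt0 M A Atame) by apply affine_slope; lra.
Qed.

Lemma halving_opp (f : pt -> R) : halving f -> halving (fun z => - f z).
Proof.
intros [Hf [H1 H2]]; split; [now apply affine_opp|split].
- rewrite <- H2; f_equal; apply region_ext; intros z; unfold inter, lt0, gt0; intuition lra.
- rewrite <- H1; f_equal; apply region_ext; intros z; unfold inter, lt0, gt0; intuition lra.
Qed.

Lemma halving_cap (f : pt -> R) : halving f -> cap A f = area A / 2.
Proof. intros [Hf [_ H]]; rewrite (area_gt0 M A Atame f Hf) in H; lra. Qed.

Lemma halving_neg (f : pt -> R) : halving f -> exists w, A w /\ f w < 0.
Proof.
intros [Hf [H _]]; apply NNPP; intros Hn; rewrite (area_empty M) in H; [lra| |].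
- now apply tame_lt0.
- intros w [H1 H2]; apply Hn; now exists w.
Qed.

Lemma halving_pos (f : pt -> R) : halving f -> exists w, A w /\ 0 < f w.
Proof.
intros H; destruct (halving_neg _ (halving_opp f H)) as [w [H1 H2]]; exists w; split; [exact H1|lra].
Qed.

(** Moving slightly from s towards w gives a point of A with f > 0 and g < 0; around it lies
    positive area that belongs to the larger half and not to the smaller one. *)
Lemma halving_nested (f g : pt -> R) (w s : pt) :
  halving f -> halving g -> (forall z, A z -> f z < 0 -> g z < 0) ->
  A w -> g w < 0 -> A s -> g s <= 0 -> 0 < f s -> False.
Proof.
intros [Hf [Ff _]] [Hg [Gg _]] H Hw Gw Hs Gs Fs.
destruct (near_point f w s Hf Fs) as [t [Ht Ft]].
assert (Hg' : affine (fun z => - g z)) by now apply affine_opp.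
assert (Gt : 0 < - g (comb t w s)) by (rewrite affine_comb by exact Hg; nra).
pose proof (area_near M A f (fun z => - g z) (comb t w s) Atame Ainterior Hf Hg'
  ltac:(apply Aconv; auto; lra) Ft Gt) as Hp.
enough (area (inter (lt0 f) A) + area (inter (gt0 f) (inter (gt0 (fun z => - g z)) A))
  <= area (inter (lt0 g) A)) by lra.
apply (area_pack M); auto using tame_lt0, tame_gt0; unfold inter, lt0, gt0.
- intros z [H1 H2]; split; auto.
- intros z [H1 [H2 H3]]; split; [lra|exact H3].
- intros z; lra.
Qed.

(** The part of A where f < 0 then misses the line g = 0, so it lies inside one half of g;
    [halving_nested] forbids the inclusion to be strict. *)
Lemma halving_one_side (f g : pt -> R) :
  halving f -> halving g -> (forall z, A z -> g z = 0 -> 0 <= f z) ->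
  forall s, A s -> g s = 0 -> f s = 0.
Proof.
intros Hf Hg H s Hs Gs.
destruct (Rle_lt_or_eq_dec _ _ (H s Hs Gs)) as [Fs|Fs]; [exfalso|auto].
destruct (halving_neg f Hf) as [w [Hw Fw]].
assert (Hside : forall k : pt -> R, affine k -> (forall z, A z -> k z = 0 -> 0 <= f z) ->
  k w < 0 -> forall z, A z -> f z < 0 -> k z < 0).
{ intros k Hk Hkz Kw z Hz Fz; apply Rnot_le_lt; intros Kz.
  destruct (zero_crossing k w z Hk Kw Kz) as [t [Ht E]].
  assert (HA' : A (comb t w z)) by (apply Aconv; auto; lra).
  pose proof (Hkz _ HA' E) as F; rewrite affine_comb in F by apply Hf; nra. }
destruct (Rtotal_order (g w) 0) as [Gw|[Gw|Gw]].
- apply (halving_nested f g w s); auto; [|lra].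
  apply Hside; auto; apply Hg.
- specialize (H w Hw Gw); lra.
- apply (halving_nested f (fun z => - g z) w s); auto using halving_opp; try lra.
  apply Hside; [apply affine_opp, Hg| |lra].
  intros z Hz Gz; apply H; [exact Hz|lra].
Qed.

(** The point o tells the two lines apart. The chord of A on g = 0 then has points on both sides of
    f = 0, and the crossing, strictly between them, cannot be a boundary point. *)
Lemma halving_cross (f g : pt -> R) (o : pt) :
  halving f -> halving g -> A o -> f o = 0 -> g o <> 0 ->
  exists x, A x /\ f x = 0 /\ g x = 0 /\ ~ bd A x.
Proof.
intros Hf Hg Ho Fo Go.
(* If f vanished wherever g does, f and g would be proportional on A; at o only f vanishes, so f
   would vanish on all of A. *)
assert (Hzero : (forall s, A s -> g s = 0 -> f s = 0) -> False).
{ intros H.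
  assert (Hpair : forall u v, A u -> A v -> g u < 0 -> 0 < g v -> g v * f u = g u * f v).
  { intros u v Hu Hv Gu Gv.
    destruct (zero_crossing g u v (proj1 Hg) Gu ltac:(lra)) as [t [Ht E]].
    assert (HA' : A (comb t u v)) by (apply Aconv; auto; lra).
    pose proof (H _ HA' E) as F.
    rewrite affine_comb in E, F by (apply Hf || apply Hg).
    assert (Et : (1 - t) * (g v * f u - g u * f v) = 0).
    { transitivity (f u * (t * g u + (1 - t) * g v) - g u * (t * f u + (1 - t) * f v)); [ring|].
      rewrite E, F; ring. }
    apply Rmult_integral in Et; lra. }
  assert (Hall : forall z, A z -> f z = 0).
  { destruct (halving_neg g Hg) as [u [Hu Gu]]; destruct (halving_pos g Hg) as [v [Hv Gv]].
    assert (Huv : f u = 0 /\ f v = 0).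
    { destruct (Rtotal_order (g o) 0) as [G|[G|G]]; [|tauto|].
      - assert (Fv : f v = 0).
        { pose proof (Hpair o v Ho Hv G Gv) as E; rewrite Fo in E; nra. }
        split; [|exact Fv]. pose proof (Hpair u v Hu Hv Gu Gv) as E; rewrite Fv in E; nra.
      - assert (Fu : f u = 0).
        { pose proof (Hpair u o Hu Ho Gu G) as E; rewrite Fo in E; nra. }
        split; [exact Fu|]. pose proof (Hpair u v Hu Hv Gu Gv) as E; rewrite Fu in E; nra. }
    destruct Huv as [Fu Fv].
    intros z Hz; destruct (Rtotal_order (g z) 0) as [G|[G|G]].
    - pose proof (Hpair z v Hz Hv G Gv) as E; rewrite Fv in E; nra.
    - now apply H.
    - pose proof (Hpair u z Hu Hz Gu G) as E; rewrite Fu in E; nra. }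
  destruct (halving_neg f Hf) as [w [Hw Fw]]; rewrite (Hall w Hw) in Fw; lra. }
assert (H1 : exists u, A u /\ g u = 0 /\ f u < 0).
{ apply NNPP; intros Hn; apply Hzero, halving_one_side; auto.
  intros z Hz Gz; apply Rnot_lt_le; intros F; apply Hn; now exists z. }
assert (H2 : exists v, A v /\ g v = 0 /\ 0 < f v).
{ apply NNPP; intros Hn; apply Hzero; intros s Hs Gs.
  enough (- f s = 0) by lra.
  apply (halving_one_side (fun z => - f z) g); auto using halving_opp.
  intros z Hz Gz; apply Rnot_lt_le; intros F; apply Hn; exists z; repeat split; auto; lra. }
destruct H1 as [u [Hu [Gu Fu]]]; destruct H2 as [v [Hv [Gv Fv]]].
destruct (zero_crossing f u v (proj1 Hf) Fu ltac:(lra)) as [t [Ht E]].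
assert (Ht0 : 0 < t).
{ rewrite affine_comb in E by apply Hf; nra. }
exists (comb t u v); split; [apply Aconv; auto; lra|split; [exact E|split]].
- rewrite affine_comb, Gu, Gv by apply Hg; ring.
- intros Hb.
  destruct (halving_neg g Hg) as [w1 [Hw1 G1]]; destruct (halving_pos g Hg) as [w2 [Hw2 G2]].
  apply (bd_between A _ u v t g w1 w2 Hb); auto; [|lra|apply Hg].
  intros ->; lra.
Qed.

End Halving.

(** * Caps over a point and crossings of a line along the chain *)

Section Counting.
Context (M : nat) (A : region) (alpha : R).
Hypothesis Atame : tame M A.
Hypothesis Ainterior : nonempty_interior A.
Hypothesis Halpha : 0 < alpha < 1 / 2.
Context (P : nat -> pt).
Hypothesis Pchord : forall i, chord A alpha (P i) (P (S i)).

Let Apos : 0 < area A := body_area_pos M A Atame Ainterior.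
Let Aconv : convex_set A := proj2 Atame.

Definition downs (f : pt -> R) (n : nat) : R :=
  nsum n (fun i => chi (down f (P i) (P (S i)))).

Lemma orbit_in (i : nat) : A (P i).
Proof. apply (Pchord i). Qed.

Lemma chord_cap_area (i : nat) : cap A (orient (P i) (P (S i))) = alpha * area A.
Proof. apply (Pchord i). Qed.

(** The cap of such a step would contain the half of A where f <= 0, of area more than alpha |A|. *)
Lemma halving_skip (f : pt -> R) (o : pt) (i : nat) :
  halving A f -> A o -> f o = 0 -> 0 < f (P i) -> 0 < f (P (S i)) ->
  orient (P i) (P (S i)) o < 0 -> False.
Proof.
intros Hf Ho Fo F1 F2 O.
assert (cap A f <= cap A (orient (P i) (P (S i)))).
{ apply (area_mono M); [apply tame_le0; [apply Hf|exact Atame]|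
    apply tame_le0; [apply affine_orient|exact Atame]|].
  intros w [H1 H2]; split; [|exact H2]; left.
  apply (chord_skip M A alpha Atame Ainterior Halpha (P i) (P (S i)) o f); auto; try lra.
  apply Hf. }
rewrite chord_cap_area, (halving_cap M A Atame f Hf) in H; nra.
Qed.

(** The cap of such a step would contain the half of A where f > 0. A segment from this half to o
    could leave the cap only at o; as o is not a boundary point, it would be strictly inside the
    chord, which would then lie on f = 0. The last hypothesis fixes the orientation in that case. *)
Lemma halving_stay (f : pt -> R) (o : pt) (i : nat) :
  halving A f -> A o -> ~ bd A o -> f o = 0 -> f (P i) <= 0 -> f (P (S i)) <= 0 ->
  orient (P i) (P (S i)) o <= 0 ->
  (f (P i) = 0 -> f (P (S i)) = 0 -> forall w, 0 < f w -> orient (P i) (P (S i)) w < 0) ->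
  False.
Proof.
intros Hf Ho Hbd Fo F1 F2 O Hline.
assert (area (inter (gt0 f) A) <= cap A (orient (P i) (P (S i)))).
{ apply (area_mono M); [apply tame_gt0; [apply Hf|exact Atame]|
    apply tame_le0; [apply affine_orient|exact Atame]|].
  intros w [Fw Hw]; split; [|exact Hw]; unfold gt0, le0 in *.
  apply Rnot_lt_le; intros Ow.
  destruct (zero_crossing (fun z => - orient (P i) (P (S i)) z) w o) as [t [Ht E]];
    [apply affine_opp, affine_orient|lra|lra|].
  assert (HA' : A (comb t w o)) by (apply Aconv; auto; lra).
  destruct (chord_between M A alpha Atame Ainterior Halpha _ _ _ (Pchord i) HA' ltac:(lra))
    as [r [Hr Er]].
  assert (Ft : f (comb t w o) <= 0) by (rewrite Er, affine_comb by apply Hf; nra).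
  rewrite affine_comb, Fo in Ft by apply Hf.
  assert (t = 0) by nra; subst t; rewrite comb_0 in *.
  assert (Hr0 : r <> 0).
  { intros ->; rewrite comb_0 in Er; apply Hbd; rewrite Er; apply (Pchord i). }
  assert (Hr1 : r <> 1).
  { intros ->; rewrite comb_1 in Er; apply Hbd; rewrite Er; apply (Pchord i). }
  rewrite Er, affine_comb in Fo by apply Hf.
  assert (f (P i) = 0) by nra. assert (f (P (S i)) = 0) by nra.
  specialize (Hline H H0 w Fw); lra. }
rewrite chord_cap_area, (proj2 (proj2 Hf)) in H; nra.
Qed.

(* The four sectors cut out by two lines through o are visited in cyclic order;
   the only exceptions would skip a whole side of the halving line. *)
Lemma downs_compare (a1 b1 a2 b2 : R) (o : pt) (n : nat) :
  A o -> ~ bd A o -> a1 * b2 - a2 * b1 <> 0 -> halving A (slope a2 b2 o) ->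
  downs (slope a1 b1 o) n <= downs (slope a2 b2 o) n + 1.
Proof.
intros Ho Hbd HD Hf2.
set (f1 := slope a1 b1 o); set (f2 := slope a2 b2 o) in *.
assert (F2o : f2 o = 0) by (unfold f2, slope; ring).
(* In the coordinates f1, f2 centred at o, the cross product of two consecutive vertices tells on
   which side of the step o lies. *)
assert (HO : forall p q, f1 p * f2 q - f2 p * f1 q = (a1 * b2 - a2 * b1) * orient p q o)
  by (intros; unfold f1, f2, slope, orient; ring).
assert (HL : forall p q w, (f1 q - f1 p) * (f2 w - f2 p) - (f2 q - f2 p) * (f1 w - f1 p)
  = (a1 * b2 - a2 * b1) * orient p q w)
  by (intros; unfold f1, f2, slope, orient; ring).
set (D := a1 * b2 - a2 * b1) in *.
destruct (Rtotal_order D 0) as [HD0|[HD0|HD0]]; [|tauto|].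
(* For D < 0 a turn goes down across the second line first; in the marked sector the crossing of the
   first line is still due. *)
- apply (nsum_telescope n _ _ (fun i => 1 - chi (0 < f1 (P i) /\ f2 (P i) <= 0))).
  { intros i; pose proof (ind_bounds (0 < f1 (P i) /\ f2 (P i) <= 0)); lra. }
  intros i; unfold down.
  pose proof (HO (P i) (P (S i))) as Oi.
  pose proof (halving_skip f2 o i Hf2 Ho F2o) as K1.
  pose proof (halving_stay f2 o i Hf2 Ho Hbd F2o) as K2.
  destruct (Rle_or_lt (f1 (P i)) 0) as [A1|A1]; destruct (Rle_or_lt (f2 (P i)) 0) as [A2|A2];
  destruct (Rle_or_lt (f1 (P (S i))) 0) as [B1|B1]; destruct (Rle_or_lt (f2 (P (S i))) 0) as [B2|B2];
  try chi_solve; exfalso.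
  + apply K2; auto; [nra|].
    intros E1 E2 w Fw; pose proof (HL (P i) (P (S i)) w) as L.
    rewrite E1, E2 in L; nra.
  + apply K1; auto; nra.
(* For D > 0 the first line comes first, and in the marked sector the crossing of the second is
   still due. *)
- apply (nsum_telescope n _ _ (fun i => chi (f1 (P i) <= 0 /\ 0 < f2 (P i)))).
  { intros i; apply ind_bounds. }
  intros i; unfold down.
  pose proof (HO (P i) (P (S i))) as Oi.
  pose proof (halving_skip f2 o i Hf2 Ho F2o) as K1.
  pose proof (halving_stay f2 o i Hf2 Ho Hbd F2o) as K2.
  destruct (Rle_or_lt (f1 (P i)) 0) as [A1|A1]; destruct (Rle_or_lt (f2 (P i)) 0) as [A2|A2];
  destruct (Rle_or_lt (f1 (P (S i))) 0) as [B1|B1]; destruct (Rle_or_lt (f2 (P (S i))) 0) as [B2|B2];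
  try chi_solve; exfalso.
  + apply K1; auto; nra.
  + apply K2; auto; [nra|].
    intros E1 E2 w Fw; pose proof (HL (P i) (P (S i)) w) as L.
    rewrite E1, E2 in L; nra.
Qed.

(* The third hypothesis says that A lies ahead of x on the line through x. *)
Lemma down_right (a b : R) (x p q : pt) :
  a * a + b * b = 1 -> A p -> A q ->
  (forall z, A z -> slope a b x z = 0 -> 0 < slope b (- a) x z) ->
  down (slope a b x) p q -> orient p q x < 0.
Proof.
intros Hab Hp Hq Hahead [Fp Fq].
set (f := slope a b x) in *; set (g := slope b (- a) x) in *.
assert (Hf : affine f) by apply affine_slope.
destruct (zero_crossing (fun z => - f z) p q (affine_opp f Hf)) as [t [Ht E]]; [lra|lra|].
set (v := comb t p q) in *.
assert (Fv : f v = 0) by lra.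
pose proof (Hahead v ltac:(apply Aconv; auto; lra) Fv) as Gv.
assert (E1 : (1 - t) * orient p q x =
  (fst p - fst x) * (snd v - snd x) - (snd p - snd x) * (fst v - fst x))
  by (unfold v, comb, orient; simpl; ring).
assert (V1 : fst v - fst x = b * g v).
{ transitivity ((fst v - fst x) * (a * a + b * b) - a * f v); [rewrite Hab, Fv; ring|].
  unfold f, g, slope; ring. }
assert (V2 : snd v - snd x = - a * g v).
{ transitivity ((snd v - snd x) * (a * a + b * b) - b * f v); [rewrite Hab, Fv; ring|].
  unfold f, g, slope; ring. }
rewrite V1, V2 in E1.
replace ((fst p - fst x) * (- a * g v) - (snd p - snd x) * (b * g v)) with (- (f p * g v)) in E1
  by (unfold f, slope; ring).
nra.
Qed.

(** On a halving line through x the body is an interval missing x, so it lies wholly ahead of x or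
    wholly behind; in the second case the line is reversed. *)
Lemma oriented_halving (x : pt) :
  ~ A x -> exists a b, a * a + b * b = 1 /\ halving A (slope a b x) /\
    forall z, A z -> slope a b x z = 0 -> 0 < slope b (- a) x z.
Proof.
intros Hx; destruct (halving_line M A Atame x) as [a [b [Hab Hc]]].
apply (halving_slope M A Atame a b x Hab) in Hc.
assert (Hno : forall z, A z -> slope a b x z = 0 -> slope b (- a) x z = 0 -> False).
{ intros z Hz F G; apply Hx; replace x with z; [exact Hz|].
  destruct z as [z1 z2], x as [x1 x2]; unfold slope in *; simpl in *; f_equal.
  - enough (z1 - x1 = 0) by lra.
    transitivity ((z1 - x1) * (a * a + b * b)); [rewrite Hab; ring|].
    transitivity (a * (a * (z1 - x1) + b * (z2 - x2)) + b * (b * (z1 - x1) + - a * (z2 - x2)));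
    [ring|rewrite F, G; ring].
  - enough (z2 - x2 = 0) by lra.
    transitivity ((z2 - x2) * (a * a + b * b)); [rewrite Hab; ring|].
    transitivity (b * (a * (z1 - x1) + b * (z2 - x2)) - a * (b * (z1 - x1) + - a * (z2 - x2)));
    [ring|rewrite F, G; ring]. }
destruct (classic (exists z, A z /\ slope a b x z = 0 /\ slope b (- a) x z < 0))
  as [[u [Hu [Fu Gu]]]|H].
- exists (- a), (- b); split; [lra|split].
  + replace (slope (- a) (- b) x) with (fun z => - slope a b x z); [now apply halving_opp|].
    apply functional_extensionality; intros z; unfold slope; ring.
  + intros z Hz Fz.
    assert (Fz' : slope a b x z = 0) by (unfold slope in *; lra).
    assert (slope b (- a) x z < 0); [|unfold slope in *; lra].
    apply Rnot_le_lt; intros Gz.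
    destruct (zero_crossing (slope b (- a) x) u z (affine_slope _ _ _) Gu Gz) as [t [Ht E]].
    apply (Hno (comb t u z)); [apply Aconv; auto; lra| |exact E].
    rewrite affine_comb, Fu, Fz' by apply affine_slope; ring.
- exists a, b; split; [exact Hab|split; [exact Hc|]].
  intros z Hz Fz; destruct (Rtotal_order (slope b (- a) x z) 0) as [G|[G|G]]; [|destruct (Hno z Hz Fz G)|exact G].
  destruct H; now exists z.
Qed.

Definition caps_at (n : nat) (x : pt) : R :=
  nsum n (fun i => chi (orient (P i) (P (S i)) x < 0)).

Lemma downs_caps (a b : R) (x : pt) (n : nat) :
  a * a + b * b = 1 -> (forall z, A z -> slope a b x z = 0 -> 0 < slope b (- a) x z) ->
  downs (slope a b x) n <= caps_at n x.
Proof.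
intros Hab H; apply nsum_le; intros i _; apply ind_le; intros Hd.
now apply (down_right a b); try apply orbit_in.
Qed.

Section Reference.
Context (y : pt) (j : nat).
Hypothesis Ay : A y.
Hypothesis yj : orient (P j) (P (S j)) y < 0.

Let f : pt -> R := orient (P j) (P (S j)).

(** The cap of step i would contain the reference cap and more, although both have area alpha
    |A|. *)
Lemma reference_skip (i : nat) :
  orient (P i) (P (S i)) y < 0 -> 0 < f (P i) -> 0 < f (P (S i)) -> False.
Proof.
intros Oy F1 F2.
pose proof (affine_orient (P j) (P (S j))) as Hf; fold f in Hf.
pose proof (affine_orient (P i) (P (S i))) as Hg.
assert (Hs : forall w, A w -> f w <= 0 -> orient (P i) (P (S i)) w < 0).
{ apply (chord_skip M A alpha Atame Ainterior Halpha _ _ y f); auto; unfold f in *; lra. }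
assert (Fa : f (P j) = 0) by apply orient_start.
pose proof (Hs (P j) (orbit_in j) ltac:(lra)) as Oa.
pose proof (cap_strict M A Atame Ainterior f (orient (P i) (P (S i))) (comb (1 / 2) (P i) (P j)) Hf Hg) as K.
rewrite chord_cap_area in K; change (cap A f) with (cap A (orient (P j) (P (S j)))) in K.
rewrite chord_cap_area in K; apply (Rlt_irrefl (alpha * area A)), K.
- intros z Hz Fz; specialize (Hs z Hz Fz); lra.
- apply Aconv; try apply orbit_in; lra.
- rewrite affine_comb, Fa by exact Hf; lra.
- rewrite affine_comb by exact Hg; rewrite orient_start; lra.
Qed.

(** The part of A left of the reference line has area (1 - alpha) |A|, too much for the cap of step
    i, so it lies left of that step. Hence the cap of step i is inside the reference cap; the areas
    being equal, both chords lie on one line and share their ends, and the direction is fixed by a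
    point to the left of both. *)
Lemma reference_stay (i : nat) :
  f (P i) <= 0 -> f (P (S i)) <= 0 -> P i = P j /\ P (S i) = P (S j).
Proof.
intros F1 F2.
pose proof (affine_orient (P j) (P (S j))) as Hf; fold f in Hf.
pose proof (affine_orient (P i) (P (S i))) as Hg.
set (g := orient (P i) (P (S i))) in *.
destruct (chord_pos M A alpha Atame Ainterior Halpha _ _ (Pchord j)) as [l [Hl Fl]]; fold f in Fl.
assert (Gl : 0 < g l).
{ destruct (Rtotal_order (g l) 0) as [G|[G|G]]; [exfalso|exfalso|exact G].
  - assert (area (inter (gt0 f) A) <= cap A g).
    { apply (area_mono M); auto using tame_le0, tame_gt0.
      intros z [Fz Hz]; split; [left|exact Hz].
      apply (chord_inside M A alpha Atame Ainterior Halpha _ _ l z f (Pchord i)); auto. }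
    rewrite (area_gt0 M A Atame f Hf) in H; unfold f, g in H; rewrite !chord_cap_area in H; nra.
  - destruct (chord_between M A alpha Atame Ainterior Halpha _ _ l (Pchord i) Hl G) as [r [Hr E]].
    rewrite E, affine_comb in Fl by exact Hf; nra. }
assert (Hpos : forall z, A z -> 0 < f z -> 0 < g z).
{ intros z Hz Fz; destruct (Rtotal_order (g z) 0) as [G|[G|G]]; [exfalso|exfalso|exact G].
  - assert (g l < 0); [|lra].
    apply (chord_inside M A alpha Atame Ainterior Halpha _ _ z l f (Pchord i)); auto.
  - destruct (chord_between M A alpha Atame Ainterior Halpha _ _ z (Pchord i) Hz G) as [r [Hr E]].
    rewrite E, affine_comb in Fz by exact Hf; nra. }
assert (Hnest : forall z, A z -> g z <= 0 -> f z <= 0).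
{ intros z Hz Gz; apply Rnot_lt_le; intros Fz; specialize (Hpos z Hz Fz); lra. }
(* With g < 0 at a, points of A near a with f > 0 would have g < 0; with g > 0 there, points near a
   towards y would show that the caps differ in area. *)
assert (Hz0 : forall a, A a -> f a = 0 -> g a = 0).
{ intros a Ha Fa; destruct (Rtotal_order (g a) 0) as [G|[G|G]]; [exfalso|exact G|exfalso].
  - destruct (near_point (fun z => - g z) l a (affine_opp g Hg)) as [t [Ht Gt]]; [lra|].
    assert (0 < g (comb t l a)); [|lra].
    apply Hpos; [apply Aconv; auto; lra|].
    rewrite affine_comb, Fa by exact Hf; nra.
  - destruct (near_point g y a Hg G) as [t [Ht Gt]].
    apply (Rlt_irrefl (alpha * area A)).
    rewrite <- (chord_cap_area i) at 1; rewrite <- (chord_cap_area j).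
    apply (cap_strict M A Atame Ainterior _ _ (comb t y a)); auto.
    + apply Aconv; auto; lra.
    + fold f; rewrite affine_comb, Fa by exact Hf; unfold f; nra. }
assert (Hend : forall k, bd A (P k) -> f (P k) = 0 -> P k = P i \/ P k = P (S i)).
{ intros k Hk Fk.
  destruct (chord_between M A alpha Atame Ainterior Halpha _ _ _ (Pchord i) (orbit_in k)
    (Hz0 _ (orbit_in k) Fk)) as [r [Hr E]].
  destruct (Req_dec r 0) as [->|R0]; [rewrite comb_0 in E; auto|].
  destruct (Req_dec r 1) as [->|R1]; [rewrite comb_1 in E; auto|exfalso].
  destruct (chord_neg M A alpha Atame Ainterior Halpha _ _ (Pchord i)) as [w1 [Hw1 G1]].
  apply (bd_between A (P k) (P i) (P (S i)) r g w1 l); auto; try apply orbit_in; try lra.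
  - exact (chord_neq M A alpha Atame Ainterior Halpha _ _ (Pchord i)).
  - apply orient_start.
  - apply orient_end. }
assert (Hbd : forall k, bd A (P k)) by (intros k; apply (Pchord k)).
pose proof (chord_neq M A alpha Atame Ainterior Halpha _ _ (Pchord j)) as Hne.
destruct (Hend j (Hbd j) (orient_start _ _)) as [Ea|Ea];
destruct (Hend (S j) (Hbd (S j)) (orient_end _ _)) as [Eb|Eb]; try congruence; [auto|exfalso].
unfold f in Fl; unfold g in Gl; rewrite <- Ea, <- Eb in Gl; unfold orient in Gl, Fl; lra.
Qed.

(** A cap over y is charged to its own step if that goes down across the reference line, otherwise
    to the preceding step. The preceding cap misses y, so no step is charged twice; the + 1 pays for
    step 0, which has no predecessor. The induction also records that a last downward step not yet
    charged saves this + 1. *)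
Lemma reference_downs (n : nat) : caps_at n y <= downs f n + 1.
Proof.
set (bad := fun i => orient (P i) (P (S i)) y < 0).
assert (Hcons : forall i, bad i -> bad (S i) -> False).
{ intros i H1 H2.
  exact (consecutive_caps M A alpha Atame Ainterior Halpha _ _ _ y (Pchord i) (Pchord (S i)) Ay H1 H2). }
assert (Hprev : forall i, bad (S i) -> ~ down f (P (S i)) (P (S (S i))) ->
  down f (P i) (P (S i)) /\ ~ bad i).
{ intros i Hb Hd; split; [|intros H; exact (Hcons i H Hb)].
  unfold down in *.
  destruct (Rle_or_lt (f (P (S i))) 0) as [F1|F1].
  - split; [|exact F1]; apply Rnot_le_lt; intros F0.
    destruct (reference_stay i F0 F1) as [E1 E2].
    apply (Hcons i); [|exact Hb]; unfold bad; rewrite E1, E2; exact yj.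
  - exfalso; destruct (Rle_or_lt (f (P (S (S i)))) 0) as [F2|F2]; [apply Hd; lra|].
    exact (reference_skip (S i) Hb F1 F2). }
(* a cap over y that does not go down across the reference line directly
   follows a step that does and whose cap misses y *)
assert (H : caps_at n y <= downs f n + 1 /\
  (forall k, n = S k -> down f (P k) (P n) -> ~ bad k -> caps_at n y <= downs f n)).
{ unfold caps_at, downs; induction n as [|n [IH1 IH2]]; simpl; [split; [lra|discriminate]|].
  fold (bad n); ind_split (bad n); ind_split (down f (P n) (P (S n))); split; try lra;
    try (intros k Ek; injection Ek as <-; intros; solve [tauto|lra]).
  destruct n as [|n]; [simpl; lra|].
  destruct (Hprev n Hi Hi0) as [K1 K2]; specialize (IH2 n eq_refl K1 K2); lra. }
apply H.
Qed.

End Reference.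

(** The line of a chord with y in its cap need not meet the halving line through x inside A, so a
    halving line through the midpoint o of the chord is put between them. The 3 is 1 for charging
    caps to crossings and 1 for each of the two changes of line. *)
Lemma caps_outside (n : nat) (x y : pt) :
  ~ A x -> A y -> caps_at n y <= caps_at n x + 3.
Proof.
intros Hx Hy.
assert (Hx0 : 0 <= caps_at n x) by (apply nsum_nonneg; intros; apply ind_bounds).
destruct (classic (exists j, orient (P j) (P (S j)) y < 0)) as [[j Hj]|Hno].
2: { replace (caps_at n y) with 0; [lra|].
  unfold caps_at; rewrite (nsum_ext n _ (fun _ => 0)); [rewrite nsum_const; ring|].
  intros i _; apply ind_false; intros H; apply Hno; now exists i. }
pose proof (reference_downs y j Hy Hj n) as H1.
destruct (oriented_halving x Hx) as [a [b [Hab [Hhalf Hahead]]]].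
pose proof (downs_caps a b x n Hab Hahead) as H4.
set (o := comb (1 / 2) (P j) (P (S j))).
assert (Ho : A o) by (apply Aconv; try apply orbit_in; lra).
assert (Hobd : ~ bd A o) by exact (chord_midpoint_not_bd M A alpha Atame Ainterior Halpha _ _ (Pchord j)).
set (a1 := - (snd (P (S j)) - snd (P j))); set (b1 := fst (P (S j)) - fst (P j)).
assert (Ef : orient (P j) (P (S j)) = slope a1 b1 o).
{ apply functional_extensionality; intros z.
  unfold orient, slope, a1, b1, o, comb; simpl; field. }
pose proof (chord_cap_area j) as Hcap; rewrite Ef in Hcap.
(* parallel lines through o coincide, but their caps have different areas *)
assert (HD : forall a2 b2, a2 * a2 + b2 * b2 = 1 -> halving A (slope a2 b2 o) ->
  a1 * b2 - a2 * b1 <> 0).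
{ intros a2 b2 Hab2 Hh HD.
  set (k := a1 * a2 + b1 * b2).
  assert (Ea : a1 = k * a2).
  { transitivity (a1 * (a2 * a2 + b2 * b2) - b2 * (a1 * b2 - a2 * b1)); [rewrite Hab2, HD; ring|].
    unfold k; ring. }
  assert (Eb : b1 = k * b2).
  { transitivity (b1 * (a2 * a2 + b2 * b2) + a2 * (a1 * b2 - a2 * b1)); [rewrite Hab2, HD; ring|].
    unfold k; ring. }
  assert (Ek : forall z, slope a1 b1 o z = k * slope a2 b2 o z).
  { intros z; unfold slope; rewrite Ea, Eb; ring. }
  destruct (chord_neg M A alpha Atame Ainterior Halpha _ _ (Pchord j)) as [w [Hw Fw]].
  rewrite Ef, Ek in Fw.
  assert (Hk : forall g, halving A g -> (forall z, slope a1 b1 o z <= 0 <-> g z <= 0) -> False).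
  { intros g Hg Hgz; assert (cap A (slope a1 b1 o) = cap A g).
    { unfold cap; f_equal; apply region_ext; intros z; unfold inter, le0.
      rewrite Hgz; tauto. }
    rewrite Hcap, (halving_cap M A Atame g Hg) in H; nra. }
  destruct (Rtotal_order k 0) as [K|[K|K]].
  - apply (Hk _ (halving_opp A _ Hh)); intros z; rewrite Ek; split; nra.
  - rewrite K in Fw; lra.
  - apply (Hk _ Hh); intros z; rewrite Ek; split; nra. }
rewrite Ef in H1.
destruct (Req_dec (slope a b x o) 0) as [Eo|Eo].
- assert (E : slope a b x = slope a b o).
  { apply functional_extensionality; intros z; unfold slope in *; lra. }
  rewrite E in H4, Hhalf.
  pose proof (downs_compare a1 b1 a b o n Ho Hobd (HD a b Hab Hhalf) Hhalf); lra.
- destruct (halving_line M A Atame o) as [a2 [b2 [Hab2 Hc2]]].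
  apply (halving_slope M A Atame a2 b2 o Hab2) in Hc2.
  pose proof (downs_compare a1 b1 a2 b2 o n Ho Hobd (HD a2 b2 Hab2 Hc2) Hc2) as H2.
  destruct (halving_cross M A Atame Ainterior _ _ o Hc2 Hhalf Ho ltac:(unfold slope; ring) Eo)
    as [o2 [Ho2 [F2 [G2 Hbd2]]]].
  assert (E1 : slope a2 b2 o = slope a2 b2 o2).
  { apply functional_extensionality; intros z; unfold slope in *; lra. }
  assert (E2 : slope a b x = slope a b o2).
  { apply functional_extensionality; intros z; unfold slope in *; lra. }
  (* Parallel lines through o2 would coincide, and the halving line of x would pass through o. *)
  assert (HD2 : a2 * b - a * b2 <> 0).
  { intros HD2; apply Eo.
    set (k := a * a2 + b * b2).
    assert (Ea : a = k * a2).
    { transitivity (a * (a2 * a2 + b2 * b2) + b2 * (a2 * b - a * b2)); [rewrite Hab2, HD2; ring|].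
      unfold k; ring. }
    assert (Eb : b = k * b2).
    { transitivity (b * (a2 * a2 + b2 * b2) - a2 * (a2 * b - a * b2)); [rewrite Hab2, HD2; ring|].
      unfold k; ring. }
    rewrite E2; transitivity (k * slope a2 b2 o2 o).
    - unfold slope; rewrite Ea at 1; rewrite Eb at 1; ring.
    - rewrite <- E1; unfold slope; ring. }
  rewrite E2 in Hhalf, H4.
  rewrite E1 in H2.
  pose proof (downs_compare a2 b2 a b o2 n Ho2 Hbd2 HD2 Hhalf); lra.
Qed.

End Counting.

(** * Averaging and passage to the limit *)

Lemma chord_orbit (M : nat) (A : region) (alpha : R) :
  Defs.closed_set A -> tame M A -> nonempty_interior A -> 0 < alpha < 1 / 2 ->
  exists P : nat -> pt, forall i, chord A alpha (P i) (P (S i)).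
Proof.
intros HC HA HI Hal.
pose proof (body_area_pos M A HA HI) as Hpos.
destruct (exists_bd M A HC HA HI) as [p0 Hp0].
set (next := fun p => epsilon (inhabits p)
  (fun q => bd A q /\ cap A (orient p q) = alpha * area A)).
assert (Hnext : forall p, bd A p -> bd A (next p) /\ cap A (orient p (next p)) = alpha * area A).
{ intros p Hp; unfold next; apply epsilon_spec.
  apply (next_chord M A HC HA p (alpha * area A) Hp); nra. }
exists (fun i => Nat.iter i next p0).
assert (Hbd : forall i, bd A (Nat.iter i next p0)).
{ induction i as [|i IH]; [exact Hp0|]. now apply Hnext. }
intros i; split; [apply Hbd|apply (Hnext _ (Hbd i))].
Qed.

Lemma nsum_cv (n : nat) (u : nat -> nat -> R) (l : nat -> R) :
  (forall i, Un_cv (u i) (l i)) -> Un_cv (fun k => nsum n (fun i => u i k)) (nsum n l).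
Proof.
intros H; induction n as [|n IH]; simpl; [apply cv_const|].
apply CV_plus; [exact IH|apply H].
Qed.

Section Nested.
Context (M : nat) (A B : region) (alpha : R).
Hypothesis Aclosed : Defs.closed_set A.
Hypothesis Atame : tame M A.
Hypothesis Ainterior : nonempty_interior A.
Hypothesis Btame : tame M B.
Hypothesis AB : forall p, A p -> B p.
Hypothesis Halpha : 0 < alpha < 1 / 2.

Let Apos : 0 < area A := body_area_pos M A Atame Ainterior.

(** [caps_outside] summed over lattice points y of A and x of B \ A, a finite double count in place
    of an exchange of integrals; [u] is the indicator of B \ A. Open caps are counted over A and
    enlarged to closed ones over B \ A. *)
Lemma lattice_average (k n : nat) (P : nat -> pt) :
  (forall i, chord A alpha (P i) (P (S i))) ->
  (cnt M k B - cnt M k A) *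
    nsum n (fun i => cnt M k (inter (lt0 (orient (P i) (P (S i)))) A)) <=
  cnt M k A *
    (nsum n (fun i => cnt M k (inter (le0 (orient (P i) (P (S i)))) B)
                    - cnt M k (inter (le0 (orient (P i) (P (S i)))) A))
     + 3 * (cnt M k B - cnt M k A)).
Proof.
intros HP.
set (g := fun i => orient (P i) (P (S i))).
set (u := fun p => chi (B p) - chi (A p)).
set (S1 := nsum n (fun i => cnt M k (inter (lt0 (g i)) A))).
assert (Hu : forall p, 0 <= u p).
{ intros p; unfold u; pose proof (ind_le (A p) (B p) (AB p)); lra. }
assert (Elu : lsum M k u = cnt M k B - cnt M k A).
{ unfold cnt; transitivity (lsum M k (fun p => chi (B p)) + lsum M k (fun p => -1 * chi (A p)));
  [|rewrite lsum_scal; ring].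
  rewrite <- lsum_plus; apply Rle_antisym; apply lsum_le; intros p; unfold u; lra. }
assert (ES1 : S1 = lsum M k (fun y => caps_at P n y * chi (A y))).
{ unfold S1, cnt; rewrite <- lsum_nsum.
  apply Rle_antisym; apply lsum_le; intros y; unfold caps_at;
  rewrite Rmult_comm, <- nsum_scal; right; apply nsum_ext; intros i _; unfold inter, lt0, g;
  ind_split (A y); ind_split (orient (P i) (P (S i)) y < 0);
  rewrite ?(ind_true (_ /\ _)) by tauto; rewrite ?(ind_false (_ /\ _)) by tauto; ring. }
assert (Hx : forall x, u x * S1 <= u x * (cnt M k A * (caps_at P n x + 3))).
{ intros x; destruct (classic (A x)) as [HAx|HAx].
  - replace (u x) with 0; [lra|]. unfold u; rewrite !ind_true by auto; ring.
  - apply Rmult_le_compat_l; [apply Hu|].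
    rewrite ES1, (Rmult_comm (cnt M k A)); unfold cnt; rewrite <- lsum_scal.
    apply lsum_le; intros y; ind_split (A y); [|lra].
    pose proof (caps_outside M A alpha Atame Ainterior Halpha P HP n x y HAx Hi); lra. }
assert (Hs : lsum M k (fun x => S1 * u x) <=
  lsum M k (fun x => cnt M k A * (u x * caps_at P n x + 3 * u x))).
{ apply lsum_le; intros x; specialize (Hx x); lra. }
rewrite !lsum_scal, lsum_plus, lsum_scal, Elu in Hs.
rewrite (Rmult_comm _ S1); apply Rle_trans with (1 := Hs).
apply Rmult_le_compat_l; [apply cnt_nonneg|].
apply Rplus_le_compat_r.
rewrite (nsum_ext n _ (fun i => lsum M k (fun x => u x * chi (g i x <= 0)))).
- rewrite <- lsum_nsum; apply lsum_le; intros x; unfold caps_at; rewrite nsum_scal.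
  apply Rmult_le_compat_l; [apply Hu|].
  apply nsum_le; intros i _; apply ind_le; unfold g; lra.
- intros i _; fold (g i); unfold cnt.
  transitivity (lsum M k (fun p => chi (inter (le0 (g i)) B p))
    + lsum M k (fun p => -1 * chi (inter (le0 (g i)) A p))); [rewrite lsum_scal; ring|].
  rewrite <- lsum_plus; apply Rle_antisym; apply lsum_le; intros x; specialize (AB x); unfold u, inter, le0;
  ind_split (A x); ind_split (B x); ind_split (g i x <= 0);
  rewrite ?(ind_true (_ /\ _)) by tauto; rewrite ?(ind_false (_ /\ _)) by tauto; (lra || tauto).
Qed.

(** Every set counted in [lattice_average] is convex, so the mesh can tend to 0, and open and closed
    caps of A have the same area. Dividing by |A| and adding back the n caps of A, of area alpha |A|
    each, turns B \ A into B. *)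
Lemma area_average (n : nat) (P : nat -> pt) :
  (forall i, chord A alpha (P i) (P (S i))) ->
  INR n * (alpha * area B) - 3 * area B
  <= nsum n (fun i => cap B (orient (P i) (P (S i)))).
Proof.
intros HP.
set (g := fun i => orient (P i) (P (S i))).
assert (Hg : forall i, affine (g i)) by (intros; apply affine_orient).
set (T := nsum n (fun i => cap B (g i))).
assert (Hc : forall i, cap A (g i) = alpha * area A) by (intros; apply HP).
assert (Hl : forall i, area (inter (lt0 (g i)) A) = alpha * area A).
{ intros i; rewrite <- (Hc i); eapply (area_lt0 M); [exact Atame|apply Hg|].
  exact (chord_nonconstant M A alpha Atame Ainterior Halpha _ _ (HP i)). }
assert (H : (area B - area A) * nsum n (fun i => area (inter (lt0 (g i)) A)) <=
  area A * (nsum n (fun i => cap B (g i) - cap A (g i)) + 3 * (area B - area A))).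
{ eapply Rle_cv_lim; [intros k; exact (lattice_average k n P HP)| |].
  - apply CV_mult.
    + apply CV_minus; apply tame_cv; assumption.
    + apply (nsum_cv n (fun i k => cnt M k (inter (lt0 (g i)) A))
        (fun i => area (inter (lt0 (g i)) A))).
      intros i; apply tame_cv, tame_lt0; auto.
  - apply CV_mult; [apply tame_cv; assumption|].
    apply CV_plus.
    + apply (nsum_cv n (fun i k => cnt M k (inter (le0 (g i)) B) - cnt M k (inter (le0 (g i)) A))
        (fun i => cap B (g i) - cap A (g i))).
      intros i; apply CV_minus; apply tame_cv, tame_le0; auto.
    + apply (CV_mult (fun _ => 3)); [apply cv_const|].
      apply CV_minus; apply tame_cv; assumption. }
rewrite (nsum_ext n _ (fun _ => alpha * area A) (fun i _ => Hl i)), nsum_const in H.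
rewrite (nsum_ext n (fun i => cap B (g i) - cap A (g i))
  (fun i => cap B (g i) - alpha * area A)) in H by (intros i _; now rewrite Hc).
rewrite nsum_minus, nsum_const in H; fold T in H.
assert (H' : (area B - area A) * (INR n * alpha) <= T - INR n * (alpha * area A) + 3 * (area B - area A)).
{ apply Rmult_le_reg_l with (area A); [exact Apos|]. lra. }
change (INR n * (alpha * area B) - 3 * area B <= T); clearbody T; lra.
Qed.

(** Pigeonhole over the n + 1 first steps, with [step n] = 1 / (n + 1). The unit normal and the
    bound on c, valid because the line passes through a point of the box, prepare the extraction of
    a limit. *)
Lemma almost_good_section (n : nat) :
  exists a b c, a * a + b * b = 1 /\ Rabs c <= 2 * INR M /\
    cap A (aff a b c) = alpha * area A /\
    alpha * area B - step n * (3 * area B) <= cap B (aff a b c).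
Proof.
destruct (chord_orbit M A alpha Aclosed Atame Ainterior Halpha) as [P HP].
assert (Hex : exists i, alpha * area B - step n * (3 * area B) <= cap B (orient (P i) (P (S i)))).
{ apply NNPP; intros Hn.
  pose proof (area_average (S n) P HP) as H.
  assert (Hlt : nsum (S n) (fun i => cap B (orient (P i) (P (S i)))) <
    INR (S n) * (alpha * area B - step n * (3 * area B))).
  { rewrite <- nsum_const; cbn [nsum]; apply Rplus_le_lt_compat.
    - apply nsum_le; intros i _; left; apply Rnot_le_lt; intros Hi; apply Hn; now exists i.
    - apply Rnot_le_lt; intros Hi; apply Hn; now exists n. }
  assert (E : INR (S n) * step n = 1) by (apply Rinv_r, not_0_INR; lia).
  assert (E' : INR (S n) * (step n * (3 * area B)) = 3 * area B)
    by (rewrite <- Rmult_assoc, E; ring).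
  lra. }
destruct Hex as [i Hi].
pose proof (chord_nonconstant M A alpha Atame Ainterior Halpha _ _ (HP i)) as Hne.
destruct (affine_unit _ _ _ (affine_orient (P i) (P (S i))) Hne) as [r [a [b [c [Hr [Hab E]]]]]].
assert (Hcap : forall K, cap K (orient (P i) (P (S i))) = cap K (aff a b c)).
{ intros K; unfold cap; f_equal; apply region_ext; intros z; unfold inter, le0; rewrite E.
  split; intros [H1 H2]; split; try exact H2; nra. }
exists a, b, c; split; [exact Hab|split; [|split]].
- assert (E0 : aff a b c (P i) = 0).
  { apply Rmult_eq_reg_l with r; [|lra]. rewrite <- E; unfold orient; ring. }
  destruct (proj1 Atame (P i)) as [Hx Hy]; [apply (HP i)|].
  apply Rabs_bounds in Hx; apply Rabs_bounds in Hy.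
  unfold aff in E0; apply Rabs_le; assert (-1 <= a <= 1) by (split; nra).
  assert (-1 <= b <= 1) by (split; nra).
  split; nra.
- rewrite <- Hcap; apply (HP i).
- rewrite <- Hcap; exact Hi.
Qed.

End Nested.

Lemma subsequence_cv (u : nat -> R) (l : R) (phi : nat -> nat) :
  Un_cv u l -> (forall k, (k <= phi k)%nat) -> Un_cv (fun k => u (phi k)) l.
Proof.
intros H Hphi eps He; destruct (H eps He) as [N HN]; exists N; intros k Hk.
apply HN; specialize (Hphi k); lia.
Qed.

(** The indices satisfy k <= phi k instead of increasing strictly: this suffices for limits, passes
    to compositions and follows at once from a cluster point. *)
Lemma bounded_subsequence (u : nat -> R) (C : R) :
  (forall n, Rabs (u n) <= C) ->
  exists (phi : nat -> nat) (l : R), (forall k, (k <= phi k)%nat) /\ Un_cv (fun k => u (phi k)) l.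
Proof.
intros H.
destruct (Bolzano_Weierstrass u (fun x => - C <= x <= C) (compact_P3 _ _)) as [l Hl].
{ intros n; apply Rabs_bounds, H. }
assert (Hex : forall k, exists p, (k <= p)%nat /\ Rabs (u p - l) < step k).
{ intros k; destruct (Hl (disc l (mkposreal _ (step_pos k))) k) as [p Hp].
  - exists (mkposreal _ (step_pos k)); intros x Hx; exact Hx.
  - exists p; exact Hp. }
exists (fun k => epsilon (inhabits 0%nat) (fun p => (k <= p)%nat /\ Rabs (u p - l) < step k)), l.
split.
- intros k; apply (epsilon_spec (inhabits 0%nat) _ (Hex k)).
- intros eps He; destruct (step_cv 1 eps He) as [N HN]; exists N; intros k Hk.
  specialize (HN k Hk); unfold Rdist in *.
  pose proof (epsilon_spec (inhabits 0%nat) _ (Hex k)) as [_ Hp].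
  apply Rlt_trans with (1 := Hp).
  rewrite Rminus_0_r, Rmult_1_r in HN.
  apply Rle_lt_trans with (1 := Rle_abs _) (2 := HN).
Qed.

Lemma cv_dist (u : nat -> R) (l : R) : Un_cv u l -> Un_cv (fun k => Rabs (l - u k)) 0.
Proof.
intros H eps He; destruct (H eps He) as [N HN]; exists N; intros k Hk.
specialize (HN k Hk); unfold Rdist in *.
now rewrite Rminus_0_r, Rabs_Rabsolu, Rabs_minus_sym.
Qed.

Lemma unit_angle (a b : R) : a * a + b * b = 1 -> exists theta, - sin theta = a /\ cos theta = b.
Proof.
intros H.
assert (Hb : -1 <= b <= 1) by (split; nra).
assert (Hs : sqrt (1 - Rsqr b) = Rabs a).
{ replace (1 - Rsqr b) with (Rsqr a) by (unfold Rsqr; lra). apply sqrt_Rsqr_abs. }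
destruct (Rle_or_lt a 0) as [Ha|Ha].
- exists (acos b); rewrite sin_acos, cos_acos, Hs by exact Hb.
  rewrite Rabs_left1 by exact Ha; lra.
- exists (- acos b); rewrite sin_neg, cos_neg, sin_acos, cos_acos, Hs by exact Hb.
  rewrite Rabs_right by lra; lra.
Qed.

(** Three nested extractions make a, b and c converge along common indices. Used in both directions,
    [area_lip] carries the equality for A to the limit line; in one direction it carries the
    inequality for B, whose defect tends to 0. *)
Lemma good_section (M : nat) (A B : region) (alpha : R) :
  Defs.closed_set A -> tame M A -> nonempty_interior A -> tame M B ->
  (forall p, A p -> B p) -> 0 < alpha < 1 / 2 ->
  exists a b c, a * a + b * b = 1 /\
    cap A (aff a b c) = alpha * area A /\ alpha * area B <= cap B (aff a b c).
Proof.
intros HC HA HI HB HAB Hal.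
pose proof (almost_good_section M A B alpha HC HA HI HB HAB Hal) as H.
set (Q := fun n (t : R * R * R) => let '(a, b, c) := t in a * a + b * b = 1 /\
    Rabs c <= 2 * INR M /\ cap A (aff a b c) = alpha * area A /\
    alpha * area B - step n * (3 * area B) <= cap B (aff a b c)).
set (s := fun n => epsilon (inhabits (0, 0, 0)) (Q n)).
assert (Hs : forall n, Q n (s n)).
{ intros n; apply epsilon_spec; destruct (H n) as [a [b [c Habc]]]; now exists (a, b, c). }
set (a := fun n => fst (fst (s n))); set (b := fun n => snd (fst (s n))); set (c := fun n => snd (s n)).
assert (Hs' : forall n, a n * a n + b n * b n = 1 /\
    Rabs (c n) <= 2 * INR M /\ cap A (aff (a n) (b n) (c n)) = alpha * area A /\
    alpha * area B - step n * (3 * area B) <= cap B (aff (a n) (b n) (c n))).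
{ intros n; specialize (Hs n); unfold a, b, c, Q in *; destruct (s n) as [[x y] z]; exact Hs. }
clearbody a b c; clear Hs s Q H.
destruct (bounded_subsequence a 1) as [f1 [a0 [Hf1 Ca]]].
{ intros n; destruct (Hs' n) as [E _]; apply Rabs_le; split; nra. }
destruct (bounded_subsequence (fun k => b (f1 k)) 1) as [f2 [b0 [Hf2 Cb]]].
{ intros n; destruct (Hs' (f1 n)) as [E _]; apply Rabs_le; split; nra. }
destruct (bounded_subsequence (fun k => c (f1 (f2 k))) (2 * INR M)) as [f3 [c0 [Hf3 Cc]]].
{ intros n; apply (Hs' (f1 (f2 n))). }
apply (subsequence_cv _ _ f2) in Ca; [|exact Hf2].
apply (subsequence_cv _ _ f3) in Ca; [|exact Hf3].
apply (subsequence_cv _ _ f3) in Cb; [|exact Hf3].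
set (f := fun k => f1 (f2 (f3 k))).
assert (Hf : forall k, (k <= f k)%nat).
{ intros k; unfold f; specialize (Hf3 k); specialize (Hf2 (f3 k)); specialize (Hf1 (f2 (f3 k))); lia. }
change (Un_cv (fun k => a (f k)) a0) in Ca.
change (Un_cv (fun k => b (f k)) b0) in Cb.
change (Un_cv (fun k => c (f k)) c0) in Cc.
assert (H0 : a0 * a0 + b0 * b0 = 1).
{ apply (UL_sequence (fun k => a (f k) * a (f k) + b (f k) * b (f k))).
  - apply CV_plus; apply CV_mult; assumption.
  - intros eps He; exists 0%nat; intros k _; rewrite (proj1 (Hs' (f k))).
    unfold Rdist; rewrite Rminus_diag, Rabs_R0; exact He. }
set (dd := fun k => lip M * (Rabs (c0 - c (f k)) +
  INR M * (Rabs (a0 - a (f k)) + Rabs (b0 - b (f k))))).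
assert (Cd : Un_cv dd 0).
{ replace 0 with (lip M * (0 + INR M * (0 + 0))) by ring.
  apply (CV_mult (fun _ => lip M)); [apply cv_const|].
  apply CV_plus; [now apply cv_dist|].
  apply (CV_mult (fun _ => INR M)); [apply cv_const|].
  apply CV_plus; now apply cv_dist. }
assert (Hlim : forall x, Un_cv (fun k => x + dd k) x).
{ intros x; rewrite <- (Rplus_0_r x) at 1; apply CV_plus; [apply cv_const|exact Cd]. }
exists a0, b0, c0; split; [exact H0|split; [apply Rle_antisym|]].
- eapply Rle_cv_lim; [|apply cv_const|apply Hlim].
  intros k; cbv beta; destruct (Hs' (f k)) as [E [_ [<- _]]].
  pose proof (area_lip M A (a (f k)) (b (f k)) (c (f k)) a0 b0 c0 HA E) as L.
  rewrite (Rabs_minus_sym (c (f k))), (Rabs_minus_sym (a (f k))), (Rabs_minus_sym (b (f k))) in L.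
  exact L.
- eapply Rle_cv_lim; [|apply cv_const|apply Hlim].
  intros k; cbv beta; destruct (Hs' (f k)) as [_ [_ [<- _]]].
  exact (area_lip M A a0 b0 c0 (a (f k)) (b (f k)) (c (f k)) HA H0).
- eapply Rle_cv_lim; [|apply cv_const|
    apply (cv_plus_step (fun k => cap B (aff a0 b0 c0) + dd k) _ (3 * area B)), Hlim].
  intros k; cbv beta; destruct (Hs' (f k)) as [_ [_ [_ L]]].
  pose proof (area_lip M B a0 b0 c0 (a (f k)) (b (f k)) (c (f k)) HB H0) as L'.
  fold (cap B (aff (a (f k)) (b (f k)) (c (f k)))) in L'; fold (cap B (aff a0 b0 c0)) in L'.
  fold (dd k) in L'.
  assert (step (f k) <= step k).
  { apply Rinv_le_contravar; [apply lt_0_INR; lia|apply le_INR; specialize (Hf k); lia]. }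
  pose proof (area_nonneg M B HB); nra.
Qed.

Theorem theorem1 (A B : region) (alpha : R) :
  convex_body A -> convex_body B -> (forall p, A p -> B p) ->
  0 < alpha < 1 / 2 ->
  exists theta t beta,
    is_section alpha A theta t /\ alpha <= beta /\ is_section beta B theta t.
Proof.
intros HA HB HAB Hal.
destruct (body_tame B HB) as [M HBt].
assert (HAt : tame M A).
{ split; [intros p Hp; apply HBt; auto|apply HA]. }
assert (HAi : nonempty_interior A) by apply HA.
assert (HBi : nonempty_interior B) by apply HB.
destruct (good_section M A B alpha (proj1 HA) HAt HAi HBt HAB Hal) as [a [b [c [Hab [HcA HcB]]]]].
pose proof (body_area_pos M A HAt HAi) as Apos.
pose proof (body_area_pos M B HBt HBi) as Bpos.
destruct (unit_angle a b Hab) as [theta [Es Ec]].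
assert (Ecap : forall K, area (inter (half_minus theta c) K) = cap K (aff a b c)).
{ intros K; unfold cap; f_equal; apply region_ext; intros z.
  unfold inter, half_minus, le0, aff; rewrite Es, Ec.
  split; intros [H1 H2]; split; try exact H2; lra. }
set (beta := cap B (aff a b c) / area B).
assert (Eb : beta * area B = cap B (aff a b c)) by (unfold beta; field; lra).
(* A section also requires beta < 1: left of the line, B contains the part of A there, which has
   area (1 - alpha) |A| > 0. *)
assert (Hgap : area (inter (gt0 (aff a b c)) A) <= area (inter (gt0 (aff a b c)) B)).
{ apply (area_mono M); [apply tame_gt0; auto using affine_aff|apply tame_gt0; auto using affine_aff|].
  intros p [H1 H2]; split; auto. }
rewrite (area_gt0 M A HAt), (area_gt0 M B HBt) in Hgap by apply affine_aff.
assert (Hbeta : alpha <= beta) by (apply Rmult_le_reg_r with (area B); lra).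
exists theta, c, beta; split; [|split; [exact Hbeta|]].
- split; [lra|]. rewrite Ecap; exact HcA.
- split; [|rewrite Ecap, Eb; reflexivity].
  split; [lra|]. apply Rmult_lt_reg_r with (area B); [exact Bpos|]. nra.
Qed.
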